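(* Let $t\in[0,1)$ and let $X$ be any (LB)-space in $\{\ell(p-),\,ces(p-),\,d(p-):1<p\le\infty\}$. (i) The generalized Cesàro operator $C_t\in\mathcal{L}(X)$ is compact. (ii) The spectra of $C_t$ are given by $\sigma_{pt}(C_t;X)=\Lambda$ and $\sigma^*(C_t;X)=\sigma(C_t;X)=\Lambda\cup\{0\}$. (iii) For each $\lambda\in\sigma_{pt}(C_t;X)$ the subspace $(\lambda I-C_t)(X)$ is closed in $X$ with $\mathrm{codim}\,(\lambda I-C_t)(X)=1$. Moreover, for each $m\in\mathbb{N}_0$, the eigenspace $\mathrm{Ker}\left(\frac{1}{m+1}I-C_t\right)$ is $1$-dimensional and equals $\mathrm{span}(x^{[m]})$, with $x^{[m]}\in d_1\subseteq X$.
   Context: $\mathbb{N}_0=\{0,1,2,\dots\}$ and $\omega:=\mathbb{C}^{\mathbb{N}_0}$ with the topology of coordinatewise convergence. For $t\in[0,1]$, $C_tx:=\left(\frac{t^nx_0+t^{n-1}x_1+\dots+x_n}{n+1}\right)_{n\in\mathbb{N}_0}$ for $x\in\omega$ (with $0^0:=1$); $C_t$ acts on a sequence space $X\subseteq\omega$ by restriction. $\Lambda:=\{\frac{1}{n+1}:n\in\mathbb{N}_0\}$. Banach spaces: $\ell^q=\ell^q(\mathbb{N}_0)$ with its usual norm $\|\cdot\|_q$, $1\le q<\infty$; $ces(q):=\{x\in\omega: C_1|x|\in\ell^q\}$ with norm $\|x\|_{ces(q)}:=\|C_1|x|\,\|_q$, $1<q<\infty$, where $|x|=(|x_n|)_n$;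 $d_q:=\{x\in\ell^\infty:\hat x\in\ell^q\}$ with norm $\|x\|_{d_q}:=\|\hat x\|_q$, $1\le q<\infty$, where $\hat x:=(\sup_{k\ge n}|x_k|)_{n\in\mathbb{N}_0}$. (LB)-spaces: for $1<p\le\infty$ fix a strictly increasing sequence $(p_k)_{k\in\mathbb{N}}\subseteq(1,p)$ with $p_k\uparrow p$. Then $\ell(p-):=\mathrm{ind}_k\,\ell^{p_k}$, $ces(p-):=\mathrm{ind}_k\,ces(p_k)$, $d(p-):=\mathrm{ind}_k\,d_{p_k}$, i.e. the union $\bigcup_kX_k$ of the respective Banach spaces $X_k$ with the finest locally convex topology making all inclusions of $X_k$ continuous. For $m\in\mathbb{N}$ define $x^{[m]}:=\alpha_m\left(0,\dots,0,1,\frac{(m+1)!}{m!\,1!}t,\frac{(m+2)!}{m!\,2!}t^2,\frac{(m+3)!}{m!\,3!}t^3,\dots\right)$ with $\alpha_m\in\mathbb{C}\setminus\{0\}$ arbitrary, where $1$ is in position $m$ (positions start at $0$), and $x^{[0]}:=\alpha_0(t^n)_{n\in\mathbb{N}_0}$ with $\alpha_0\in\mathbb{C}\setminus\{0\}$ arbitrary. For a locally convex Hausdorff space $X$, $\mathcal{L}(X)$ is the space of continuous linear operators on $X$. $T:X\to X$ linear is compact if there is a neighbourhood $\mathcal{U}$ of $0$ with $T(\mathcal{U})$ relatively compact in $X$. For $T\in\mathcal{L}(X)$: $\rho(T;X)$ is the set of $\lambda\in\mathbb{C}$ such that $R(\lambda,T):=(\lambda I-T)^{-1}$ exists in $\mathcal{L}(X)$;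 $\sigma(T;X):=\mathbb{C}\setminus\rho(T;X)$; $\sigma_{pt}(T;X)$ is the set of $\lambda$ such that $\lambda I-T$ is not injective; $\rho^*(T;X)$ is the set of $\lambda$ for which there is $\delta>0$ such that the open disc $B(\lambda,\delta)\subseteq\rho(T;X)$ and $\{R(\mu,T):\mu\in B(\lambda,\delta)\}$ is equicontinuous in $\mathcal{L}(X)$; $\sigma^*(T;X):=\mathbb{C}\setminus\rho^*(T;X)$. *)

(* Defs.v *)
From HB Require Import structures.
From mathcomp Require Import all_boot all_order all_algebra.
From mathcomp Require Import complex.
From mathcomp Require Import all_classical all_reals all_analysis.

Set Implicit Arguments.
Unset Strict Implicit.
Unset Printing Implicit Defensive.

Import Order.TTheory GRing.Theory Num.Theory Normc.
Import numFieldNormedType.Exports.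

Local Open Scope classical_set_scope.
Local Open Scope ring_scope.

Section lnorm.
Context {R : realType}.
Implicit Types (q r : R) (f g : nat -> \bar R).
Local Open Scope ereal_scope.

Definition lnorm q f : \bar R := 'N[counting]_(q%:E)[f].

Lemma lnorm_ge0 q f : 0 <= lnorm q f. Proof. exact: Lnorm_ge0. Qed.

Lemma lnormE q f : (0 < q)%R -> (forall n, 0 <= f n) ->
  lnorm q f = (\sum_(0 <= k <oo) f k `^ q) `^ q^-1.
Proof.
move=> q0 f0; rewrite /lnorm Lnorm_counting//; congr (_ `^ _).
by apply: eq_eseriesr => k _; rewrite gee0_abs.
Qed.

Lemma le_poweR q (x y : \bar R) : (0 <= q)%R -> 0 <= x -> x <= y ->
  x `^ q <= y `^ q.
Proof.
move=> q0 x0 xy; apply: gt0_ler_poweR => //; rewrite in_itv/= ?leey ?andbT//.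
exact: le_trans xy.
Qed.

Lemma le_lnorm q f g : (0 < q)%R -> (forall n, 0 <= f n) ->
  (forall n, f n <= g n) -> lnorm q f <= lnorm q g.
Proof.
move=> q0 f0 fg; have g0 n : 0 <= g n by exact: le_trans (fg n).
rewrite !lnormE//; apply: le_poweR.
- by rewrite invr_ge0 ltW.
- by apply: nneseries_ge0 => n _ _; exact: poweR_ge0.
- apply: lee_nneseries => [n _ _|n _]; [exact: poweR_ge0|].
  exact/le_poweR/fg/f0/ltW.
Qed.

Lemma lnormZ q (c : R) f : (0 < q)%R -> (0 <= c)%R -> (forall n, 0 <= f n) ->
  lnorm q (fun n => c%:E * f n) = c%:E * lnorm q f.
Proof.
move=> q0 c0 f0; rewrite !lnormE//; last by move=> n; rewrite mule_ge0.
under eq_eseriesr do rewrite poweRM// poweR_EFin.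
rewrite nneseriesZl; last by move=> *; exact: poweR_ge0.
rewrite poweRM ?lee_fin ?powR_ge0//; last first.
  by apply: nneseries_ge0 => n _ _; exact: poweR_ge0.
by rewrite poweR_EFin -powRrM mulfV ?gt_eqF// powRr1.
Qed.

Lemma coord_le_lnorm q f n : (0 < q)%R -> (forall n, 0 <= f n) ->
  f n <= lnorm q f.
Proof.
move=> q0 f0; rewrite lnormE//.
rewrite [leLHS](_ : _ = (f n `^ q) `^ q^-1); last first.
  by rewrite -poweRrM mulfV ?gt_eqF// poweRe1.
apply: le_poweR; [by rewrite invr_ge0 ltW|exact: poweR_ge0|].
have /(_ (fun k _ _ => poweR_ge0 _ _)) :=
  @nneseries_lim_ge R (fun k => f k `^ q) xpredT 0%N n.+1.
apply: le_trans.
rewrite big_nat_recr//= leeDr// sume_ge0// => i _; exact: poweR_ge0.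
Qed.

Lemma lnormD q f g : (1 <= q)%R -> (forall n, 0 <= f n) ->
  (forall n, 0 <= g n) -> lnorm q (fun n => f n + g n) <= lnorm q f + lnorm q g.
Proof.
move=> q1 f0 g0; have q0 : (0 < q)%R by exact: lt_le_trans q1.
have [->|fy] := eqVneq (lnorm q f) +oo.
  by rewrite addye ?leey// gt_eqF// (lt_le_trans _ (lnorm_ge0 _ _)).
have [->|gy] := eqVneq (lnorm q g) +oo.
  by rewrite addey ?leey// gt_eqF// (lt_le_trans _ (lnorm_ge0 _ _)).
have fin h : (forall n, 0 <= h n) -> lnorm q h != +oo ->
    h = EFin \o (fine \o h).
  move=> h0 hy; apply/funext => n /=; rewrite fineK// ge0_fin_numE//.
  by rewrite (le_lt_trans (coord_le_lnorm n q0 h0))// ltey.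
rewrite (fin f)// (fin g)//.
by apply: (@minkowski_EFin _ _ R (@counting nat R) (fine \o f) (fine \o g)).
Qed.

Lemma lnorm_le q r f : (0 < q)%R -> (q <= r)%R -> (forall n, 0 <= f n) ->
  lnorm r f <= lnorm q f.
Proof.
move=> q0 qr f0; have r0 : (0 < r)%R by exact: lt_le_trans qr.
have [->|sy] := eqVneq (lnorm q f) +oo; first by rewrite leey.
have /fineK sE : lnorm q f \is a fin_num.
  by rewrite ge0_fin_numE ?ltey// lnorm_ge0.
have := sE; set s := fine _ => {}sE.
have s0 : (0 <= s)%R by rewrite fine_ge0// lnorm_ge0.
have sumE : \sum_(0 <= k <oo) f k `^ q = (s `^ q)%:E.
  rewrite -poweR_EFin sE lnormE// -poweRrM mulVf ?gt_eqF// poweRe1//.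
  by apply: nneseries_ge0 => n _ _; exact: poweR_ge0.
have pow x : x != 0%R -> (x `^ r = x `^ (r - q) * x `^ q)%R.
  by move=> x0; rewrite -powRD subrK// (gt_eqF r0).
have fs n : f n `^ r <= (s `^ (r - q))%:E * f n `^ q.
  have := coord_le_lnorm n q0 f0; rewrite -sE.
  case: (f n) (f0 n) => [x| |]//; rewrite !lee_fin => x0 xs.
  have [->|xn0] := eqVneq x 0%R.
    by rewrite !powR0 ?gt_eqF// mulr0.
  rewrite (pow _ xn0).
  by rewrite ler_wpM2r ?powR_ge0// ge0_ler_powR ?nnegrE// subr_ge0.
rewrite -sE lnormE//.
rewrite [leRHS](_ : _ = (s `^ r)%:E `^ r^-1); last first.
  by rewrite poweR_EFin -powRrM mulfV ?gt_eqF// powRr1.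
apply: le_poweR; first by rewrite invr_ge0 ltW.
  by apply: nneseries_ge0 => n _ _; exact: poweR_ge0.
apply: le_trans (lee_nneseries _ (fun n _ => fs n)) _.
  by move=> n _ _; exact: poweR_ge0.
rewrite nneseriesZl; last by move=> *; exact: poweR_ge0.
rewrite sumE -EFinM lee_fin.
have [->|sn0] := eqVneq s 0%R.
  by rewrite (@powR0 _ q) ?gt_eqF// mulr0 powR_ge0.
by rewrite -pow.
Qed.

End lnorm.

Notation omega R := (nat -> R[i]).

Definition cesaro_op (K : fieldType) (t : K) (x : nat -> K) : nat -> K :=
  fun n => (\sum_(i < n.+1) t ^+ (n - i) * x i) / n.+1%:R.

Inductive seqfamily := ell | ces | dd.

(* The three Banach norms are [q]-norms of a sequence attached to [x], namely
   |x|, C_1 |x| and \hat x.  They are taken with values in [\bar R], the Banach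
   space being the set where the norm is finite; for [dd] the sequence \hat x
   is constantly +oo when x is unbounded, so that finiteness includes
   x \in \ell^\infty (see [banach_dd_bounded]). *)
Definition majorant (R : realType) (F : seqfamily) (x : omega R) (n : nat) :
    \bar R :=
  match F with
  | ell => (normc (x n))%:E
  | ces => (cesaro_op 1 (fun k => normc (x k)) n)%:E
  | dd => ereal_sup [set (normc (x k))%:E | k in [set k | (n <= k)%N]]
  end.

Definition bnorm (R : realType) F (q : R) (x : omega R) : \bar R :=
  lnorm q (majorant F x).

Definition banach (R : realType) F (q : R) : set (omega R) :=
  [set x | (bnorm F q x < +oo)%E].

Section bnorm.
Context {R : realType}.
Implicit Types (x y : omega R) (q r : R) (F : seqfamily) (a : R[i]).
Local Open Scope ereal_scope.

Lemma normc_ge0 (z : R[i]) : (0 <= normc z)%R.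
Proof. by case: z => u v; exact: sqrtr_ge0. Qed.

Lemma majorant_ge0 F x n : 0 <= majorant F x n.
Proof.
case: F => /=; rewrite ?lee_fin ?normc_ge0//.
  rewrite divr_ge0// sumr_ge0// => i _.
  by rewrite expr1n mul1r normc_ge0.
apply: ereal_sup_ge; exists (normc (x n))%:E; first by exists n => /=.
by rewrite lee_fin normc_ge0.
Qed.

Lemma le_cesaro1 (u v : nat -> R) : (forall n, u n <= v n)%R ->
  forall n, (cesaro_op 1 u n <= cesaro_op 1 v n)%R.
Proof.
move=> uv n; rewrite /cesaro_op ler_wpM2r ?invr_ge0//.
by apply: ler_sum => i _; rewrite expr1n !mul1r.
Qed.

Lemma majorantD F x y n :
  majorant F (x + y)%R n <= majorant F x n + majorant F y n.
Proof.
case: F => /=; rewrite -?EFinD ?lee_fin; first exact: le_normcD.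
- rewrite (le_trans (le_cesaro1 (fun k => le_normcD (x k) (y k)) n))//.
  rewrite /cesaro_op -mulrDl -big_split/=.
  by under eq_bigr do rewrite mulrDr.
- apply: ge_ereal_sup => _ [k/= nk <-].
  rewrite (@le_trans _ _ ((normc (x k))%:E + (normc (y k))%:E))//.
    by rewrite -EFinD lee_fin le_normcD.
  by apply: leeD; apply: ereal_sup_ubound; exists k.
Qed.

Lemma le_majorantZ F a x n :
  majorant F (a *: x) n <= (normc a)%:E * majorant F x n.
Proof.
case: F => /=; rewrite -?EFinM ?lee_fin; first by rewrite -normcM.
- rewrite /cesaro_op mulrA mulr_sumr; under eq_bigr do rewrite normcM mulrCA.
  exact: lexx.
- apply: ge_ereal_sup => _ [k/= nk <-].
  rewrite [normc _]normcM EFinM lee_wpmul2l ?lee_fin ?normc_ge0//.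
  by apply: ereal_sup_ubound; exists k.
Qed.

Lemma bnorm_ge0 F q x : 0 <= bnorm F q x. Proof. exact: lnorm_ge0. Qed.

Lemma bnormD F q x y : (1 <= q)%R ->
  bnorm F q (x + y)%R <= bnorm F q x + bnorm F q y.
Proof.
move=> q1; apply: le_trans (lnormD q1 (majorant_ge0 F x) (majorant_ge0 F y)).
apply: le_lnorm; first exact: lt_le_trans q1.
- exact: majorant_ge0.
- exact: majorantD.
Qed.

Lemma bnormZ F q a x : (0 < q)%R ->
  bnorm F q (a *: x) = (normc a)%:E * bnorm F q x.
Proof.
move=> q0.
have leZ b y : bnorm F q (b *: y) <= (normc b)%:E * bnorm F q y.
  rewrite /bnorm -lnormZ//; [|exact: normc_ge0|exact: majorant_ge0].
  by apply: le_lnorm => // n; [exact: majorant_ge0|exact: le_majorantZ].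
apply/eqP; rewrite eq_le leZ/=.
have [->|a0] := eqVneq a 0%R; first by rewrite normc0 mul0e bnorm_ge0.
have na0 : normc a != 0%R by apply: contra a0 => /eqP/eq0_normc ->.
have := leZ a^-1%R (a *: x); rewrite scalerA mulVf// scale1r normcV => h.
apply: le_trans (lee_wpmul2l _ h) _; first by rewrite lee_fin normc_ge0.
by rewrite muleA -EFinM mulfV// mul1e.
Qed.

Lemma bnorm_le F q r x : (0 < q)%R -> (q <= r)%R -> bnorm F r x <= bnorm F q x.
Proof. by move=> q0 qr; apply: lnorm_le => //; exact: majorant_ge0. Qed.

Lemma banach_dd_bounded q x : (0 < q)%R -> banach dd q x ->
  exists M, forall n, (normc (x n) <= M)%R.
Proof.
move=> q0 xq; have h := coord_le_lnorm 0 q0 (majorant_ge0 dd x).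
have fin : majorant dd x 0 \is a fin_num.
  by rewrite ge0_fin_numE ?majorant_ge0// (le_lt_trans h).
exists (fine (majorant dd x 0)) => n; rewrite -lee_fin fineK//.
by apply: ereal_sup_ubound; exists n.
Qed.

End bnorm.

(* An increasing sequence of seminormed spaces of sequences, the k-th one being
   the set where [lbnorm k] is finite, normed by [lbnorm k]. *)
Record lbseq (R : realType) := LBSeq {
  lbnorm :> nat -> omega R -> \bar R ;
  lbnorm_ge0 : forall k x, (0 <= lbnorm k x)%E ;
  lbnormD : forall k x y, (lbnorm k (x + y)%R <= lbnorm k x + lbnorm k y)%E ;
  lbnormZ : forall k (a : R[i]) x,
    lbnorm k (a *: x) = ((normc a)%:E * lbnorm k x)%E ;
  lbnorm_nonincr : forall k x, (lbnorm k.+1 x <= lbnorm k x)%E }.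

Definition lbset (R : realType) (E : lbseq R) : set (omega R) :=
  \bigcup_k [set x | (E k x < +oo)%E].

Record indlim (R : realType) (E : lbseq R) := IndLim {
  ilval : omega R ;
  ilvalP : ilval \in lbset E }.
Arguments ilval {R E}.

HB.instance Definition _ R (E : lbseq R) := [isSub for @ilval R E].
HB.instance Definition _ R (E : lbseq R) := [Choice of indlim E by <:].

Section lbset_submod.
Context {R : realType} (E : lbseq R).

Lemma lbnorm_mono x : {homo (fun k => E k x) : m n / (m <= n)%N >-> (n <= m)%E}.
Proof.
apply: homo_leq => [k//|y z u h1 h2|k]; first exact: le_trans h2 h1.
exact: lbnorm_nonincr.
Qed.

Lemma lbnorm0 k : E k 0 = 0%E.
Proof. by rewrite -(scale0r (0 : omega R)) lbnormZ normc0 mul0e. Qed.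

Lemma lbset_submod : GRing.submod_closed (fun x => x \in lbset E).
Proof.
split; first by rewrite inE; exists 0%N => //=; rewrite lbnorm0.
move=> a x y; rewrite !inE => -[m _ /= xm] [n _ /= yn].
exists (maxn m n) => //=; apply: le_lt_trans (lbnormD _ _ _ _) _.
rewrite lbnormZ lte_add_pinfty//.
  rewrite lte_mul_pinfty ?lee_fin ?normc_ge0//.
  by rewrite (le_lt_trans _ xm)// lbnorm_mono// leq_maxl.
by rewrite (le_lt_trans _ yn)// lbnorm_mono// leq_maxr.
Qed.

End lbset_submod.

HB.instance Definition _ R (E : lbseq R) :=
  GRing.SubChoice_isSubLmodule.Build R[i] (omega R) (fun x => x \in lbset E)
    (indlim E) (lbset_submod E).

Definition absconvex (K : numDomainType) (V : lmodType K) (U : set V) :=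
  forall (a b : K) x y, `|a| + `|b| <= 1 -> U x -> U y -> U (a *: x + b *: y).

(* Zero-neighbourhood base of the finest locally convex topology making all the
   inclusions of the k-th spaces continuous; see [indlim_inclusion_continuous]
   and [indlim_finest]. *)
Definition ind_base (R : realType) (E : lbseq R) (U : set (indlim E)) :=
  absconvex U /\
  forall k, exists2 e : R, 0 < e &
    forall x : indlim E, (E k (ilval x) < e%:E)%E -> U x.

Definition ind_nbhs (R : realType) (E : lbseq R) (x : indlim E) :
    set_system (indlim E) :=
  [set A | exists2 U, ind_base U & forall y, U y -> A (x + y)].
Arguments ind_nbhs {R E}.

Section ind_topology.
Context {R : realType} {E : lbseq R}.
Implicit Types (x y : indlim E) (U V : set (indlim E)).

Lemma ind_base0 U : ind_base U -> U 0.
Proof.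
by move=> [_ /(_ 0%N) [e e0]]; apply; rewrite lbnorm0 lte_fin.
Qed.

Lemma ind_baseI U V : ind_base U -> ind_base V -> ind_base (U `&` V).
Proof.
move=> [aU bU] [aV bV]; split.
  by move=> a b x y ab [? ?] [? ?]; split; [exact: aU|exact: aV].
move=> k; have [e e0 eU] := bU k; have [d d0 dV] := bV k.
exists (Num.min e d); first by rewrite lt_min e0.
move=> x; rewrite EFin_min lt_min => /andP[xe xd].
by split; [exact: eU|exact: dV].
Qed.

Lemma ind_base_scale U (c : R[i]) : c != 0 -> ind_base U ->
  ind_base [set x | U (c *: x)].
Proof.
move=> c0 [aU bU]; split.
  move=> a b x y ab /= xU yU.
  by rewrite scalerDr !scalerA ![c * _]mulrC -!scalerA; exact: aU.
have nc0 : 0 < normc c.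
  rewrite lt_neqAle normc_ge0 andbT eq_sym.
  by apply: contra c0 => /eqP/eq0_normc ->.
move=> k; have [e e0 eU] := bU k; exists (e / normc c).
  by rewrite divr_gt0.
move=> x xe /=; apply: eU; rewrite [ilval _](_ : _ = c *: ilval x)// lbnormZ.
by rewrite muleC -lte_pdivlMr.
Qed.

Lemma ind_base_half U x y : ind_base U ->
  U (2 *: x) -> U (2 *: y) -> U (x + y).
Proof.
move=> [aU _] xU yU.
have := aU 2^-1 2^-1 _ _ _ xU yU; rewrite !scalerA mulVf// !scale1r; apply.
by rewrite ger0_norm ?invr_ge0// -[X in X + _]mul1r -[X in _ + X]mul1r -splitr.
Qed.

Lemma ind_base_absorb U x : ind_base U ->
  exists2 d : R, 0 < d & forall c : R[i], normc c < d -> U (c *: x).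
Proof.
move=> [_ bU]; have := ilvalP x; rewrite inE => -[k _ /= xk].
have [e e0 eU] := bU k.
have M0 := lbnorm_ge0 E k (ilval x).
have /fineK ME : E k (ilval x) \is a fin_num by rewrite ge0_fin_numE.
set M := fine _ in ME.
have M0' : 0 <= M by rewrite -lee_fin ME.
have M1 : 0 < M + 1 by rewrite ltr_wpDl.
exists (e / (M + 1)); first by rewrite divr_gt0.
move=> c cd; apply: eU; rewrite [ilval _](_ : _ = c *: ilval x)// lbnormZ -ME.
rewrite -EFinM lte_fin; apply: le_lt_trans (_ : normc c * (M + 1) < e).
  by rewrite ler_wpM2l ?normc_ge0// lerDl.
by rewrite -ltr_pdivlMr.
Qed.

Lemma ind_nbhs_filter x : ProperFilter (ind_nbhs x).
Proof.
apply: Build_ProperFilter_ex.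
  by move=> A [U /ind_base0 U0 UA]; exists (x + 0); exact: UA.
split.
- exists setT => //; split=> // k; exists 1 => //.
- move=> A B [U bU UA] [V bV VB]; exists (U `&` V); first exact: ind_baseI.
  by move=> y [/UA ? /VB].
- by move=> A B AB [U bU UA]; exists U => // y /UA /AB.
Qed.

Lemma ind_nbhs_singleton x (A : set (indlim E)) : ind_nbhs x A -> A x.
Proof. by move=> [U /ind_base0 U0 UA]; rewrite -(addr0 x); exact: UA. Qed.

Lemma ind_nbhs_nbhs x (A : set (indlim E)) :
  ind_nbhs x A -> ind_nbhs x (ind_nbhs^~ A).
Proof.
move=> [U bU UA]; have bU2 : ind_base [set y | U (2 *: y)].
  exact: ind_base_scale.
exists [set y | U (2 *: y)] => // y yU; exists [set y | U (2 *: y)] => // z zU.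
by rewrite -addrA; apply: UA; exact: ind_base_half.
Qed.

End ind_topology.

HB.instance Definition _ R (E : lbseq R) := hasNbhs.Build (indlim E) ind_nbhs.
HB.instance Definition _ R (E : lbseq R) := Nbhs_isNbhsTopological.Build
  (indlim E) ind_nbhs_filter ind_nbhs_singleton ind_nbhs_nbhs.

Section ind_tvs.
Context {R : realType} {E : lbseq R}.
Implicit Types (x y : indlim E) (U V : set (indlim E)).

Lemma ind_add_continuous :
  continuous (fun z : indlim E * indlim E => z.1 + z.2).
Proof.
move=> [x y] A [U bU UA]; have bU2 : ind_base [set y | U (2 *: y)].
  exact: ind_base_scale.
exists ([set x' | U (2 *: (x' - x))], [set y' | U (2 *: (y' - y))]) => /=.
  split; exists [set y | U (2 *: y)] => // z /=; by rewrite addrAC subrr add0r.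
move=> [x' y'] /= [x'U y'U].
have := UA _ (ind_base_half bU x'U y'U).
by rewrite /= addrACA !(addrC _ (- _)) !addNKr addrC ?addNKr; congr A;
  rewrite ?addrA.
Qed.

Lemma ind_scale_continuous :
  continuous (fun z : R[i]^o * indlim E => z.1 *: z.2).
Proof.
move=> [a x] A [U bU UA].
have c0 : `|a| + 1 != 0 :> R[i] by rewrite gt_eqF// ltr_wpDl.
have [d d0 dU] := ind_base_absorb (2 *: x) bU.
pose V := [set v : indlim E | U ((2 * (`|a| + 1)) *: v)].
have bV : ind_base V by apply: ind_base_scale => //; rewrite mulf_neq0.
exists ([set b | `|b - a| < (Num.min 1 d)%:C%C], [set y | V (y - x)]) => /=.
  split.
    apply/nbhs_ballP; exists (Num.min 1 d)%:C%C => /=.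
      by rewrite ltcR lt_min d0 ltr01.
    by move=> b; rewrite /ball/= distrC.
  by exists V => // v; rewrite /= addrAC subrr add0r.
move=> [b y] /= [].
rewrite [X in X < _](_ : _ = (normc (b - a))%:C%C)// ltcR lt_min.
move=> /andP[ba1 bad] yV.
have -> : b *: y = a *: x + ((b - a) *: x + b *: (y - x)).
  by rewrite scalerBl scalerBr addrA (addrC (a *: x)) subrK addrC subrK.
apply: UA; apply: (ind_base_half bU).
  by rewrite scalerA mulrC -scalerA; exact: dU.
have [aU _] := bU.
have b1 : `|(b : R[i]) / (`|a : R[i]| + 1)| + `|0 : R[i]| <= 1.
  rewrite normr0 addr0 normf_div (@ger0_norm _ (_ + 1)) ?addr_ge0//.
  rewrite ler_pdivrMr ?mul1r ?ltr_wpDl// -[b](subrK a) addrC.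
  apply: le_trans (ler_normD _ _) _; rewrite lerD2l.
  by rewrite [leLHS](_ : _ = (normc (b - a))%:C%C)// lecR ltW.
have := aU _ _ _ _ b1 yV yV; rewrite scale0r addr0 scalerA.
by rewrite mulrCA divfK// -scalerA.
Qed.

Lemma convex_ind_interior U : ind_base U -> forall x,
  convex_set [set y | nbhs y [set z | U (z - x)]].
Proof.
move=> bU x y1 y2 l; rewrite !inE => -[V bV VU] [W bW WU].
exists (V `&` W); first exact: ind_baseI.
move=> v [/VU /= y1U /WU /= y2U]; case: bU => aU _.
have l1 : `|l%:num| + `|1 - l%:num| <= 1 :> R[i].
  by rewrite !ger0_norm ?subr_ge0// addrC subrK.
have := aU _ _ _ _ l1 y1U y2U; congr U.
change (l%:num *: (y1 + v - x) + (1 - l%:num) *: (y2 + v - x) =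
  (l%:num *: y1 + (1 - l%:num) *: y2) + v - x).
rewrite -!addrA !(scalerDr _ _ (v - x)) addrACA -scalerDl (addrC l%:num) subrK.
by rewrite scale1r addrA.
Qed.

Lemma ind_locally_convex : exists2 B : set_system (indlim E),
  (forall b, b \in B -> convex_set b) & basis B.
Proof.
exists [set O | open O /\ convex_set O]; first by move=> O; rewrite inE => -[].
split; first by move=> O [].
move=> x A [U bU UA].
exists [set y | nbhs y [set z | U (z - x)]].
  split; first by split; [exact: open_interior|exact: convex_ind_interior].
  by exists U => // v /=; rewrite addrAC subrr add0r.
move=> y /nbhs_singleton/= /UA; by rewrite addrC subrK.
Qed.

End ind_tvs.

(* In this version of the library this factory only installs the uniform
   structure. *)
HB.instance Definition _ R (E : lbseq R) := PreTopologicalLmod_isTvs.Build R[i]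
  (indlim E) ind_add_continuous ind_scale_continuous ind_locally_convex.
HB.instance Definition _ R (E : lbseq R) :=
  PreTopologicalNmodule_isTopologicalNmodule.Build (indlim E)
    ind_add_continuous.
HB.instance Definition _ R (E : lbseq R) :=
  TopologicalNmodule_isTopologicalLmodule.Build R[i] (indlim E)
    ind_scale_continuous.
HB.instance Definition _ R (E : lbseq R) :=
  Uniform_isTvs.Build R[i] (indlim E) ind_locally_convex.

Section ind_finest.
Context {R : realType} {E : lbseq R}.

Lemma indlim_inclusion_continuous (A : set (indlim E)) k :
  nbhs (0 : indlim E) A ->
  exists2 e : R, 0 < e & forall x, (E k (ilval x) < e%:E)%E -> A x.
Proof.
move=> [U [_ /(_ k) [e e0 eU]] UA]; exists e => // x /eU/UA.
by rewrite add0r.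
Qed.

Lemma indlim_finest (F : tvsType R[i]) (f : {linear indlim E -> F}) :
  (forall k (A : set F), nbhs (0 : F) A ->
    exists2 e : R, 0 < e & forall x, (E k (ilval x) < e%:E)%E -> A (f x)) ->
  continuous f.
Proof.
move=> fE x A fxA.
have [B Bconvex [Bopen Bnbhs]] := @locally_convex R[i] F.
have A0 : nbhs (0 : F) [set w | A (f x + w)].
  have := nbhsB (- f x) fxA; rewrite addNr; apply: filterS => _ [w Aw <-] /=.
  by rewrite addNKr.
have [b [Bb b0] bA] := Bnbhs 0 _ A0.
pose U := [set y : indlim E | forall c : R[i], `|c| <= 1 -> b (f (c *: y))].
exists U; last first.
  move=> y /(_ 1); rewrite normr1 scale1r => /(_ (lexx _))/bA/=.
  by rewrite -linearD.
have bnbhs0 : nbhs (0 : F) b by apply: open_nbhs_nbhs; split=> //; exact: Bopen.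
split; last first.
  move=> k; have [e e0 eb] := fE k _ bnbhs0; exists e => // y ye c c1.
  apply: eb; rewrite [ilval _](_ : _ = c *: ilval y)// lbnormZ.
  apply: le_lt_trans ye; rewrite -[leRHS]mul1e lee_wpmul2r ?lbnorm_ge0//.
  by rewrite lee_fin -lecR.
move=> a1 a2 y1 y2 a12 y1U y2U c c1.
set s := `|a1| + `|a2|.
have [s0|s0] := eqVneq s 0.
  have : `|a1| == 0 /\ `|a2| == 0.
    by apply/andP; rewrite -paddr_eq0// -/s s0.
  rewrite !normr_eq0 => -[/eqP-> /eqP->].
  by rewrite !scale0r addr0 scaler0 linear0.
have sgt0 : 0 < s by rewrite lt_neqAle eq_sym s0 addr_ge0.
have key a (y : indlim E) : U y -> b (f ((c * (s * (a / `|a|))) *: y)).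
  move=> yU; apply: yU; rewrite !normrM normfV normr_id (ger0_norm (ltW sgt0)).
  rewrite mulr_ile1// ?mulr_ge0 ?invr_ge0 ?(ltW sgt0)//.
  rewrite mulr_ile1 ?invr_ge0 ?(ltW sgt0) ?mulr_ge0 ?invr_ge0//.
  by have [->|?] := eqVneq `|a| 0; rewrite ?mul0r ?divff.
have l0 : 0 <= `|a1| / s by rewrite divr_ge0 ?(ltW sgt0).
have l1 : `|a1| / s <= 1 by rewrite ler_pdivrMr// mul1r lerDl.
have {}key1 : f ((c * (s * (a1 / `|a1|))) *: y1) \in b.
  by rewrite inE; exact: key.
have {}key2 : f ((c * (s * (a2 / `|a2|))) *: y2) \in b.
  by rewrite inE; exact: key.
have := Bconvex b (mem_set Bb) _ _ (Itv01 l0 l1) key1 key2.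
rewrite inE; congr b.
have onemE : 1 - `|a1| / s = `|a2| / s.
  by rewrite -(divff s0) -mulrBl /s addrAC subrr add0r.
have scE (a : R[i]) : `|a| / s * (c * (s * (a / `|a|))) = c * a.
  have [->|an0] := eqVneq a 0; first by rewrite normr0 !(mul0r, mulr0).
  have na0 : `|a| != 0 by rewrite normr_eq0.
  by rewrite mulrCA; congr (c * _); rewrite mulrA divfK// mulrC divfK.
change (`|a1| / s *: f ((c * (s * (a1 / `|a1|))) *: y1) +
  (1 - `|a1| / s) *: f ((c * (s * (a2 / `|a2|))) *: y2) =
  f (c *: (a1 *: y1 + a2 *: y2))).
have fZ (a : R[i]) z : a *: f z = f (a *: z) by rewrite linearZ.
by rewrite onemE !fZ -linearD !scalerA !scE scalerDr !scalerA.
Qed.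

End ind_finest.

Record exponents (R : realType) (p : \bar R) := Exponents {
  expo :> nat -> R ;
  expo_incr : {homo expo : j k / (j < k)%N >-> j < k} ;
  expo_gt1 : forall k, 1 < expo k ;
  expo_lt : forall k, ((expo k)%:E < p)%E ;
  expo_cvg : (fun k => (expo k)%:E) @ \oo --> p }.

Section LB.
Context {R : realType} (F : seqfamily) (p : \bar R) (s : exponents p).

Let s_gt0 k : 0 < s k. Proof. exact: lt_trans (expo_gt1 s k). Qed.

Let LB_D k (x y : omega R) :
  (bnorm F (s k) (x + y)%R <= bnorm F (s k) x + bnorm F (s k) y)%E.
Proof. exact/bnormD/ltW/expo_gt1. Qed.

Let LB_Z k (a : R[i]) x :
  bnorm F (s k) (a *: x) = ((normc a)%:E * bnorm F (s k) x)%E.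
Proof. exact/bnormZ/s_gt0. Qed.

Let LB_le k (x : omega R) : (bnorm F (s k.+1) x <= bnorm F (s k) x)%E.
Proof. by apply: bnorm_le; [exact: s_gt0|exact/ltW/expo_incr]. Qed.

Definition LB : lbseq R :=
  LBSeq (fun k => bnorm_ge0 F (s k)) LB_D LB_Z LB_le.

End LB.

(* [equicontinuous] asks for a pointed codomain. *)
Definition pointed_tvs (K : numDomainType) (X : tvsType K) : Type := X.
HB.instance Definition _ (K : numDomainType) (X : tvsType K) :=
  Uniform.on (pointed_tvs X).
HB.instance Definition _ (K : numDomainType) (X : tvsType K) :=
  isPointed.Build (pointed_tvs X) (0 : X).

Section operators.
Context {K : numFieldType} {X : tvsType K}.
Implicit Types (T S : X -> X) (l mu : K) (Y : set X).

Definition compact_operator T :=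
  exists2 U, nbhs (0 : X) U & precompact (T @` U).

Definition pencil T l : X -> X := fun x => l *: x - T x.

Definition is_resolvent T l S :=
  [/\ linear S, continuous S, cancel (pencil T l) S & cancel S (pencil T l)].

Definition resolvent_set T : set K := [set l | exists S, is_resolvent T l S].

Definition spectrum T : set K := ~` resolvent_set T.

Definition point_spectrum T : set K := [set l | ~ injective (pencil T l)].

Definition resolvent_set_star T : set K :=
  [set l | exists2 delta : K, 0 < delta &
    ball l delta `<=` resolvent_set T /\
    equicontinuous
      ([set S | exists2 mu, ball l delta mu & is_resolvent T mu S]
        : set (X -> pointed_tvs X)) id].

Definition spectrum_star T : set K := ~` resolvent_set_star T.

(* [Y] is meant to be a linear subspace; [has_codim] says that the classes of
   the [e i] form a basis of the quotient by [Y]. *)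
Definition has_dim Y n := exists e : 'I_n -> X, (forall i, Y (e i)) /\
  forall x, Y x -> exists! c : 'rV[K]_n, x = \sum_i c 0 i *: e i.

Definition has_codim Y n := exists e : 'I_n -> X,
  forall x, exists! c : 'rV[K]_n, Y (x - \sum_i c 0 i *: e i).

End operators.

Definition Lambda (K : fieldType) : set K := [set n.+1%:R^-1 | n in [set: nat]].

(* For m = 0 the coefficients n! / (0! n!) are 1, which gives alpha (t^n)_n. *)
Definition eigenseq (K : fieldType) (t : K) (m : nat) (alpha : K) : nat -> K :=
  fun n => if (n < m)%N then 0
    else alpha * (n`!%:R / (m`!%:R * (n - m)`!%:R) * t ^+ (n - m)).

(* Main.v *)
(* For l <> 0, the equation l x - C_t x = y is solved through z = C_t x: since
   C_t is inverted coordinatewise by z |-> ((n + 1) z_n - t n z_{n-1})_n, the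
   sequence z satisfies the first order recursion
     (l (n + 1) - 1) z_n = y_n + l t n z_{n-1},
   and x = (y + z) / l.  As l t (n + 1) / (l (n + 1) - 1) tends to t < 1, the
   solution z is dominated by K C_r |y| for some r < 1, with constants that are
   locally uniform in l.  The only obstruction, for l = 1 / (m + 1), is the
   equation of index m, which is one linear condition on y_0, ..., y_m.

   All continuity and compactness statements come from one smoothing estimate:
   if the majorant of x (|x|, C_1 |x| or \hat x) is bounded by A and |z| is at
   most K C_r |x|, then the majorant of z is bounded by A K / (1 - r) times
   w = C_1 (1 / (n + 1))_n, a sequence lying in \ell^q for all q > 1.  The set
   of x with majorant at most a multiple of w is compact in X, because on it
   coordinatewise convergence implies norm convergence in the first step of the
   inductive limit.

   Finally 0 is in the spectrum because C_t maps normalized vectors supported on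
   [n, oo[ to a sequence tending to 0 in X. *)
Require Import Defs.
From HB Require Import structures.
From mathcomp Require Import all_boot all_order all_algebra.
From mathcomp Require Import complex.
From mathcomp Require Import all_classical all_reals all_analysis.
From mathcomp Require Import ring lra zify.

Set Implicit Arguments.
Unset Strict Implicit.
Unset Printing Implicit Defensive.

Import Order.TTheory GRing.Theory Num.Theory Normc.
Import numFieldNormedType.Exports.

Local Open Scope classical_set_scope.
Local Open Scope ring_scope.
Local Open Scope complex_scope.

(** * The sequence C_1 (1 / (n + 1)) *)

Section real_sequences.
Context {R : realType}.
Implicit Types (c q r : R) (n : nat).

(** Apply ln (1 + u) <= u to the inverse ratio (n + 1) / (n + 2) = 1 - 1 / (n + 2). *)
Lemma ln_succ_ge n : (n.+2%:R)^-1 <= ln n.+2%:R - ln n.+1%:R :> R.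
Proof.
have n1 : 0 < n.+1%:R :> R by [].
have n2 : 0 < n.+2%:R :> R by [].
rewrite -ln_div ?posrE// -[_ / _]invf_div lnV ?posrE ?divr_gt0//.
have -> : n.+1%:R / n.+2%:R = 1 + - n.+2%:R^-1 :> R.
  apply: (mulIf (lt0r_neq0 n2)); rewrite mulrBl !divfK ?gt_eqF//.
  by rewrite mulVf ?gt_eqF// mul1r -[in RHS]natr1 addrK.
rewrite lerNr le_ln1Dx// ltrN2 invf_lt1//.
by rewrite ltr1n.
Qed.

Lemma harmonic_sum_le_ln n :
  \sum_(i < n.+1) harmonic i <= 1 + ln n.+1%:R :> R.
Proof.
elim: n => [|n ih]; first by rewrite big_ord1 /= ln1 addr0 invr1.
rewrite big_ord_recr /=; apply: le_trans (lerD ih (ln_succ_ge n)) _.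
by rewrite -addrA subrKC.
Qed.

(** c ln x = ln (x^c), and a logarithm is at most its argument. *)
Lemma ln_le_powR c (x : R) : 0 < c -> 1 <= x -> ln x <= c^-1 * x `^ c.
Proof.
move=> c0 x1; have x0 : 0 < x by exact: lt_le_trans x1.
rewrite mulrC ler_pdivlMr// mulrC -ln_powR.
by apply/ltW/ln_sublinear; rewrite powR_gt0.
Qed.

(** Factor out (n + 2)^(-c): the ratio of the two powers is e^u with u = c (ln (n + 2) - ln (n +
    1)), and e^u >= 1 + u >= 1 + c / (n + 2). Summing over n bounds the p-series. *)
Lemma powR_succ_telescope c n : 0 < c ->
  c * n.+2%:R `^ (- (1 + c)) <= n.+1%:R `^ (- c) - n.+2%:R `^ (- c) :> R.
Proof.
move=> c0; have n20 : n.+2%:R != 0 :> R by [].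
rewrite opprD powRD ?n20 ?implybT// powR_inv1//.
have -> : n.+1%:R `^ (- c) =
    n.+2%:R `^ (- c) * expR (c * (ln n.+2%:R - ln n.+1%:R)) :> R.
  by rewrite /powR !pnatr_eq0/= -expRD; congr expR; ring.
rewrite -[X in _ - X]mulr1 -mulrBr mulrA mulrC.
rewrite ler_wpM2l ?powR_ge0//.
rewrite lerBrDl; apply: le_trans _ (expR_ge1Dx _).
by rewrite lerD2l ler_wpM2l ?ln_succ_ge// ltW.
Qed.

Lemma p_series_bounded c n : 0 < c ->
  \sum_(0 <= i < n) i.+1%:R `^ (- (1 + c)) <= 1 + c^-1 :> R.
Proof.
move=> c0; case: n => [|n].
  by rewrite big_geq// addr_ge0// invr_ge0 ltW.
(* Keeping the remainder of the telescoping sum makes the induction close. *)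
suff : \sum_(0 <= i < n.+1) i.+1%:R `^ (- (1 + c)) <=
    1 + c^-1 - c^-1 * n.+1%:R `^ (- c) :> R.
  have : 0 <= c^-1 * n.+1%:R `^ (- c).
    by rewrite mulr_ge0 ?powR_ge0// invr_ge0 ltW.
  lra.
elim: n => [|n ih]; first by rewrite big_nat1 !powR1; lra.
rewrite big_nat_recr//=; have := powR_succ_telescope n c0.
rewrite mulrC -ler_pdivlMr// [X in _ <= X]mulrC mulrBr; lra.
Qed.

Definition cesaro_harmonic : nat -> R := cesaro_op 1 harmonic.

Lemma cesaro_harmonicE n :
  cesaro_harmonic n = (\sum_(i < n.+1) harmonic i) / n.+1%:R.
Proof.
by congr (_ / _); apply: eq_bigr => i _; rewrite expr1n mul1r.
Qed.

Lemma harmonic_le_cesaro n : harmonic n <= cesaro_harmonic n.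
Proof.
rewrite cesaro_harmonicE -[leLHS]mul1r ler_wpM2r ?harmonic_ge0//.
by rewrite big_ord_recl /= invr1 lerDl sumr_ge0.
Qed.

Lemma cesaro_harmonic_ge0 n : 0 <= cesaro_harmonic n.
Proof. exact: le_trans (harmonic_ge0 n) (harmonic_le_cesaro n). Qed.

Lemma cesaro_harmonic_le_powR c n : 0 < c ->
  cesaro_harmonic n <= (1 + c^-1) * n.+1%:R `^ (c - 1).
Proof.
move=> c0; rewrite cesaro_harmonicE powRB ?pnatr_eq0 ?implybT// powRr1//.
rewrite mulrA ler_wpM2r//.
apply: le_trans (harmonic_sum_le_ln n) _; rewrite mulrDl mul1r lerD//.
  by rewrite -[leLHS](powRr0 n.+1%:R) ler_powR ?ler1n// ltW.
by rewrite ln_le_powR// ler1n.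
Qed.

Lemma lnorm_lty q (u : nat -> R) (B : R) : 0 < q -> (forall n, 0 <= u n) ->
  (forall n, \sum_(0 <= i < n) u i `^ q <= B) ->
  (lnorm q (EFin \o u) < +oo)%E.
Proof.
move=> q0 u0 uB; rewrite lnormE//.
have /poweR_lty -> // : (\sum_(0 <= k <oo) (u k)%:E `^ q < +oo)%E.
apply: (@le_lt_trans _ _ B%:E); last exact: ltry.
apply: lime_le.
  by apply: is_cvg_nneseries => n _ _; exact: poweR_ge0.
near=> n; under eq_bigr do rewrite poweR_EFin.
by rewrite sumEFin lee_fin.
Unshelve. all: by end_near. Qed.

Lemma lnorm_cesaro_harmonic q : 1 < q ->
  (lnorm q (EFin \o cesaro_harmonic) < +oo)%E.
Proof.
move=> q1; have q0 : 0 < q by lra.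
(* With w_n <= (1 + 1 / b) (n + 1)^(b - 1), the q-th power has exponent (b - 1) q = c - q, which
   equals -(1 + c) for this c, so the p-series bound applies. *)
pose c := (q - 1) / 2; pose b := c / q.
have c0 : 0 < c by rewrite divr_gt0// subr_gt0.
have b0 : 0 < b by rewrite divr_gt0.
have bE : (b - 1) * q = - (1 + c).
  by rewrite mulrBl divfK ?gt_eqF// /c; field.
apply: (@lnorm_lty _ _ ((1 + b^-1) `^ q * (1 + c^-1))) => // n.
  exact: cesaro_harmonic_ge0.
apply: (@le_trans _ _ (\sum_(0 <= i < n)
    (1 + b^-1) `^ q * i.+1%:R `^ (- (1 + c)))).
  apply: ler_sum => i _; rewrite -bE powRrM -powRM ?powR_ge0//; last first.
    by rewrite addr_ge0// invr_ge0 ltW.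
  rewrite ge0_ler_powR ?nnegrE ?(ltW q0) ?cesaro_harmonic_le_powR//.
    exact: cesaro_harmonic_ge0.
  by rewrite mulr_ge0 ?powR_ge0// addr_ge0// invr_ge0 ltW.
by rewrite -mulr_sumr ler_wpM2l ?powR_ge0// p_series_bounded.
Qed.

End real_sequences.
Arguments cesaro_harmonic {R}.

(** * Majorants *)

Section majorant_estimates.
Context {R : realType}.
Implicit Types (F : seqfamily) (x y z : omega R) (q r A K : R) (n : nat).

Lemma cesaro1_le_cst A (u : nat -> R) n : (forall k, (k <= n)%N -> u k <= A) ->
  cesaro_op 1 u n <= A.
Proof.
move=> uA; rewrite /cesaro_op ler_pdivrMr//.
apply: le_trans (ler_sum _ (fun i _ => _ : _ <= A)) _.
  by move=> i _; rewrite expr1n mul1r uA// -ltnS.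
by rewrite sumr_const card_ord mulr_natr.
Qed.

Lemma le_majorant_cst F x A n : (forall k, normc (x k) <= A) ->
  (majorant F x n <= A%:E)%E.
Proof.
move=> xA; case: F => /=; rewrite ?lee_fin//; first exact: cesaro1_le_cst.
by apply: ge_ereal_sup => _ [k _ <-]; rewrite lee_fin.
Qed.

(** The factor n + 1 comes from [ces], where |x_n| is one of the n + 1 terms averaged. *)
Lemma normc_le_majorant F x n :
  ((normc (x n))%:E <= n.+1%:R%:E * majorant F x n)%E.
Proof.
have le1 (a : \bar R) : (0 <= a -> a <= n.+1%:R%:E * a)%E.
  by move=> a0; rewrite -[leLHS]mul1e lee_wpmul2r// lee_fin ler1n.
case: F => /=.
- by apply: le1; rewrite lee_fin normc_ge0.
- rewrite -EFinM lee_fin /cesaro_op mulrC divfK ?pnatr_eq0//.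
  rewrite big_ord_recr/= expr1n mul1r lerDr sumr_ge0// => i _.
  by rewrite expr1n mul1r normc_ge0.
- apply: (@le_trans _ _ (majorant dd x n)).
    by apply: ereal_sup_ubound; exists n => /=.
  exact/le1/majorant_ge0.
Qed.

(** Bounds on the majorant pass to coordinatewise limits. For [ell] and [ces] the bound at n
    involves finitely many coordinates; for [dd] the supremum is tested one index k >= n at a time,
    approximating up to k. *)
Lemma majorant_closed F x (c : nat -> R) :
  (forall n e, 0 < e -> exists y, [/\ forall k, (majorant F y k <= (c k)%:E)%E
    & forall k, (k <= n)%N -> normc (x k - y k) < e]) ->
  forall n, (majorant F x n <= (c n)%:E)%E.
Proof.
move=> xy n.
have le_normc k e y : normc (x k - y k) < e -> normc (x k) <= normc (y k) + e.
  move=> xye; rewrite -[x k](subrK (y k)) addrC.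
  by apply: le_trans (le_normcD _ _) _; rewrite lerD2l ltW.
case: F xy => /= xy.
- rewrite lee_fin; apply/ler_addgt0Pr => e e0.
  have [y [yc xye]] := xy n e e0.
  apply: le_trans (le_normc _ _ _ (xye n (leqnn _))) _.
  by rewrite lerD2r -lee_fin.
- rewrite lee_fin; apply/ler_addgt0Pr => e e0.
  have [y [yc xye]] := xy n e e0.
  apply: (@le_trans _ _ (cesaro_op 1 (fun k => normc (y k)) n + e)); last first.
    by rewrite lerD2r -lee_fin.
  rewrite /cesaro_op -[e](@mulfK _ n.+1%:R)// -mulrDl ler_wpM2r//.
  have -> : e * n.+1%:R = \sum_(i < n.+1) e.
    by rewrite sumr_const card_ord mulr_natr.
  rewrite -big_split/=; apply: ler_sum => i _; rewrite expr1n !mul1r.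
  by apply: le_normc; apply: xye; rewrite -ltnS.
- apply: ge_ereal_sup => _ [k/= nk <-]; rewrite lee_fin.
  apply/ler_addgt0Pr => e e0; have [y [yc xye]] := xy k e e0.
  apply: le_trans (le_normc _ _ _ (xye k (leqnn _))) _.
  rewrite lerD2r -lee_fin; apply: le_trans _ (yc n).
  by apply: ereal_sup_ubound; exists k.
Qed.

Lemma geometric_sum_le r n : 0 <= r -> r < 1 ->
  \sum_(i < n) r ^+ i <= (1 - r)^-1.
Proof.
move=> r0 r1; rewrite -[leRHS]mul1r ler_pdivlMr ?subr_gt0// mulrC.
by rewrite -opprB mulNr -subrX1 opprB lerBlDr lerDl exprn_ge0.
Qed.

Lemma cesaro_op_le_cst r A (u : nat -> R) n : 0 <= r -> r < 1 ->
  (forall k, 0 <= u k) -> (forall k, u k <= A) ->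
  cesaro_op r u n <= A / (1 - r) * harmonic n.
Proof.
move=> r0 r1 u0 uA; rewrite /cesaro_op /= ler_wpM2r//.
have A0 : 0 <= A := le_trans (u0 0%N) (uA 0%N).
apply: (@le_trans _ _ (\sum_(i < n.+1) A * r ^+ (n - i))).
  by apply: ler_sum => i _; rewrite mulrC ler_wpM2r// exprn_ge0.
rewrite -mulr_sumr ler_wpM2l// (reindex_inj rev_ord_inj)/=.
under eq_bigr => i _ do rewrite subSS subKn -1?ltnS//.
exact: geometric_sum_le.
Qed.

(** Summation by parts: the partial sums of u are (k + 1) (C_1 u)_k, and 1 / (k + 1) - 1 / (k + 2) =
    1 / ((k + 1) (k + 2)). *)
Lemma sum_harmonic_mul (u : nat -> R) n :
  \sum_(i < n.+1) u i / i.+1%:R =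
  cesaro_op 1 u n + \sum_(i < n) cesaro_op 1 u i / i.+2%:R.
Proof.
have cE k : cesaro_op 1 u k * k.+1%:R = \sum_(i < k.+1) u i.
  by rewrite divfK// ?pnatr_eq0//; apply: eq_bigr => i _; rewrite expr1n mul1r.
elim: n => [|n ih].
  by rewrite big_ord1 big_ord0 addr0 /cesaro_op big_ord1 expr0 mul1r.
rewrite big_ord_recr/= ih [in RHS]big_ord_recr/= addrAC [RHS]addrCA [RHS]addrC.
congr (_ + _); apply: (@mulIf _ n.+2%:R); first by rewrite pnatr_eq0.
rewrite [RHS]mulrDl cE !mulrDl !divfK ?pnatr_eq0// big_ord_recr/= -cE.
by rewrite -[n.+2%:R]natr1 mulrDr mulr1 addrAC.
Qed.

(** Only the averages of u are bounded here, not u itself. Replacing 1 / (k + 1) by 1 / (i + 1) for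
    i <= k and summing over k first leaves a geometric series times the sum of u_i / (i + 1), which
    summation by parts expresses through C_1 u. *)
Lemma cesaro1_cesaro_le r A (u : nat -> R) n : 0 <= r -> r < 1 ->
  (forall k, 0 <= u k) -> (forall k, cesaro_op 1 u k <= A) ->
  cesaro_op 1 (cesaro_op r u) n <= A / (1 - r) * cesaro_harmonic n.
Proof.
move=> r0 r1 u0 uA; have r10 : 0 <= (1 - r)^-1 by rewrite invr_ge0 subr_ge0 ltW.
rewrite cesaro_harmonicE mulrA {1}/cesaro_op ler_wpM2r//.
under eq_bigr do rewrite expr1n mul1r.
(* The triangle i <= k is padded with zeros to a square so that the sums can be exchanged. *)
apply: (@le_trans _ _ (\sum_(k < n.+1) \sum_(i < n.+1)
   if (i <= k)%N then r ^+ (k - i) * (u i / i.+1%:R) else 0)).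
  apply: ler_sum => k _; rewrite -big_mkcond/= big_ord_narrow_leq/=.
    by rewrite -ltnS.
  move=> kn; rewrite /cesaro_op mulr_suml; apply: ler_sum => i _ /=.
  rewrite -mulrA ler_wpM2l ?exprn_ge0// ler_wpM2l//.
  by rewrite lef_pV2 ?posrE// ler_nat ltn_ord.
rewrite exchange_big/=.
apply: (@le_trans _ _ (\sum_(i < n.+1) (1 - r)^-1 * (u i / i.+1%:R))).
  apply: ler_sum => i _; rewrite -big_mkcond/= -mulr_suml ler_wpM2r//.
    by rewrite divr_ge0.
  apply: le_trans _ (geometric_sum_le n.+1 r0 r1).
  rewrite -(big_mkord (fun k => (i <= k)%N) (fun k => r ^+ (k - i))).
  rewrite -(big_nat_widenl i 0%N n.+1 xpredT)//.
  rewrite -{1}(add0n (i : nat)) big_addn big_mkord.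
  under eq_bigr do rewrite addnK.
  rewrite -(big_mkord xpredT (fun k => r ^+ k)).
  rewrite -[leRHS](big_mkord xpredT (fun k => r ^+ k)).
  rewrite [leRHS](big_cat_nat (leq0n (n.+1 - i)) (leq_subr _ _))/=.
  by rewrite lerDl sumr_ge0// => k _; exact: exprn_ge0.
rewrite -mulr_sumr [A / _]mulrC -mulrA ler_wpM2l//.
rewrite sum_harmonic_mul mulrC big_ord_recl/= invr1 mulrDl mul1r mulr_suml.
rewrite lerD//; apply: ler_sum => i _.
by rewrite mulrC ler_wpM2l.
Qed.

(** For [ell] and [dd] the coordinates of x are at most A, so C_r |x| is at most A / (1 - r) times 1
    / (n + 1), a nonincreasing sequence below w. For [ces] the factor w itself comes from averaging
    1 / (n + 1). *)
Lemma majorant_cesaro F r A K x z : 0 <= r -> r < 1 -> 0 <= K ->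
  (forall n, (majorant F x n <= A%:E)%E) ->
  (forall n, normc (z n) <= K * cesaro_op r (fun k => normc (x k)) n) ->
  forall n, (majorant F z n <= (A * (K / (1 - r)) * cesaro_harmonic n)%:E)%E.
Proof.
move=> r0 r1 K0 xA zK n; have xn0 k := normc_ge0 (x k).
have A0 : 0 <= A.
  by rewrite -lee_fin; exact: le_trans (majorant_ge0 F x 0) (xA 0%N).
have r10 : 0 <= (1 - r)^-1 by rewrite invr_ge0 subr_ge0 ltW.
have -> : A * (K / (1 - r)) = K * (A / (1 - r)) by rewrite mulrCA.
have bnd k : (forall k, normc (x k) <= A) ->
    normc (z k) <= K * (A / (1 - r)) * harmonic k.
  move=> xA'; apply: le_trans (zK k) _; rewrite -mulrA ler_wpM2l//.
  exact: cesaro_op_le_cst.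
have c0 : 0 <= K * (A / (1 - r)) by rewrite !mulr_ge0.
case: F xA => /= xA.
- rewrite lee_fin; apply: le_trans (bnd n _) _ => //.
  by rewrite ler_wpM2l// harmonic_le_cesaro.
- rewrite lee_fin; apply: le_trans (le_cesaro1 zK n) _.
  rewrite -mulrA.
  rewrite [leLHS](_ : _ = K * cesaro_op 1
     (cesaro_op r (fun k => normc (x k))) n); last first.
    rewrite /cesaro_op mulrA mulr_sumr; congr (_ / _).
    by apply: eq_bigr => i _; rewrite !expr1n !mul1r.
  by rewrite ler_wpM2l// cesaro1_cesaro_le.
- have xA' k : normc (x k) <= A.
    rewrite -lee_fin; apply: le_trans _ (xA k).
    by apply: ereal_sup_ubound; exists k => /=.
  apply: ge_ereal_sup => _ [k/= nk <-]; rewrite lee_fin.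
  apply: le_trans (bnd k xA') _; rewrite ler_wpM2l//.
  apply: le_trans _ (harmonic_le_cesaro n).
  by rewrite /= lef_pV2 ?posrE// ler_nat.
Qed.

End majorant_estimates.

(** * Norms of dominated sequences *)

Section bnorm_estimates.
Context {R : realType}.
Implicit Types (F : seqfamily) (x y z : omega R) (q r A C d e : R) (n J : nat).
Local Open Scope ereal_scope.

Lemma majorant_le_bnorm F q x n : (0 < q)%R -> majorant F x n <= bnorm F q x.
Proof. by move=> q0; apply: coord_le_lnorm => // k; exact: majorant_ge0. Qed.

Lemma bnorm_le_harmonic F q C x : (1 < q)%R -> (0 <= C)%R ->
  (forall n, majorant F x n <= (C * cesaro_harmonic n)%:E) ->
  bnorm F q x <= C%:E * lnorm q (EFin \o cesaro_harmonic).
Proof.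
move=> q1 C0 xC; have q0 : (0 < q)%R by exact: lt_trans q1.
rewrite -lnormZ//=; last by move=> n; rewrite lee_fin cesaro_harmonic_ge0.
by apply: le_lnorm => // n; exact: majorant_ge0.
Qed.

(** The q-norm is at most the 1-norm, which is J d here. *)
Lemma lnorm_head q d J : (1 <= q)%R -> (0 <= d)%R ->
  lnorm q (fun n => if (n < J)%N then d%:E else 0) <= (J%:R * d)%:E.
Proof.
move=> q1 d0.
have h0 n : 0 <= (if (n < J)%N then d%:E else 0) by case: ifP.
apply: le_trans (lnorm_le ltr01 q1 h0) _.
rewrite lnormE// invr1 poweRe1; last first.
  by apply: nneseries_ge0 => *; exact: poweR_ge0.
rewrite (nneseries_split 0%N J); last by move=> *; exact: poweR_ge0.
rewrite eseries_cond eseries0 ?adde0; last first.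
  by move=> k _ /=; rewrite add0n leqNgt => /negbTE ->; rewrite poweRe1.
rewrite add0n big_mkord (eq_bigr (fun=> d%:E)); last first.
  by move=> i _; rewrite ltn_ord poweRe1.
by rewrite sumEFin lee_fin sumr_const card_ord mulr_natl.
Qed.

Lemma lnorm_tail q (u : nat -> R) e : (0 < q)%R -> (forall n, 0 <= u n)%R ->
  lnorm q (EFin \o u) < +oo -> (0 < e)%R ->
  exists J, lnorm q (fun n => if (n < J)%N then 0 else (u n)%:E) <= e%:E.
Proof.
move=> q0 u0 uoo e0.
have sumoo : \sum_(0 <= k <oo) (u k)%:E `^ q < +oo.
  rewrite ltey; apply/eqP => uE; move: uoo.
  rewrite lnormE//= uE poweRyr ?ltxx//.
  by rewrite invr_eq0 gt_eqF.
have [J _ uJ] : \forall J \near \oo,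
    \sum_(J <= k <oo) (u k)%:E `^ q < (e `^ q)%:E.
  have /= := @nneseries_tail_cvg R _ xpredT sumoo
    (fun k _ => poweR_ge0 _ _).
  move=> /(_ [set y | y < (e `^ q)%:E]); apply.
  by apply: open_ereal_lt'; rewrite lte_fin powR_gt0.
exists J; rewrite lnormE//; last by move=> n; case: ifP => //; rewrite lee_fin.
rewrite (nneseries_split 0%N J); last by move=> *; exact: poweR_ge0.
rewrite big1_seq ?add0e; last first.
  move=> k /andP[_]; rewrite mem_index_iota add0n => /andP[_ ->].
  by rewrite poweR0r// gt_eqF.
rewrite add0n eseries_cond.
rewrite (eq_eseriesr (g := fun k => (u k)%:E `^ q)); last first.
  by move=> k /= Jk; rewrite ltnNge Jk.
rewrite -eseries_cond [leRHS](_ : _ = (e `^ q)%:E `^ q^-1); last first.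
  by rewrite poweR_EFin -powRrM mulfV ?gt_eqF// powRr1// ltW.
apply: le_poweR; first by rewrite invr_ge0 ltW.
  by apply: nneseries_ge0 => *; exact: poweR_ge0.
exact/ltW/uJ/leqnn.
Qed.

(** Dominated convergence: split the majorant at J1; the tail is small because w is in l^q, the head
    because finitely many coordinates of z are small. *)
Lemma bnorm_dominated F q C e : (1 < q)%R -> (0 <= C)%R -> (0 < e)%R ->
  exists J, exists2 d, (0 < d)%R & forall z,
    (forall n, majorant F z n <= (C * cesaro_harmonic n)%:E) ->
    (forall k, (k < J)%N -> (normc (z k) < d)%R) -> bnorm F q z < e%:E.
Proof.
move=> q1 C0 e0; have q0 : (0 < q)%R by exact: lt_trans q1.
have u0 n : (0 <= C * cesaro_harmonic n)%R.
  by rewrite mulr_ge0 ?cesaro_harmonic_ge0.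
have uoo : lnorm q (EFin \o (fun n => C * cesaro_harmonic n)%R) < +oo.
  rewrite (_ : EFin \o _ = fun n => C%:E * (EFin \o cesaro_harmonic) n)//.
  rewrite lnormZ//=; last by move=> n; rewrite lee_fin cesaro_harmonic_ge0.
  by rewrite lte_mul_pinfty// lnorm_cesaro_harmonic.
have e30 : (0 < e / 3)%R by rewrite divr_gt0.
have [J1 J1e] := lnorm_tail q0 u0 uoo e30.
(* The head has J1 terms, so majorants at most d contribute at most e / 3; the successor avoids
   dividing by 0. *)
pose d := (e / 3 / J1.+1%:R)%R; have d0 : (0 < d)%R by rewrite divr_gt0.
(* For [dd] the majorant in the head sees all later coordinates; from J2 on, domination by C w alone
   makes them at most d. *)
have [J2 J2d] := lnorm_tail q0 u0 uoo d0.
exists (maxn J1 J2), d => // z zC zd.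
have small k : (J2 <= k)%N -> (C * cesaro_harmonic k <= d)%R.
  move=> J2k; rewrite -lee_fin; apply: le_trans _ J2d.
  rewrite [leLHS](_ : _ = if (k < J2)%N then 0 else (C * cesaro_harmonic k)%:E).
    apply: (@coord_le_lnorm _ q (fun k => if (k < J2)%N then 0
      else (C * cesaro_harmonic k)%:E) k q0) => n.
    by case: ifP => // _; rewrite lee_fin.
  by rewrite ltnNge J2k.
have head n : (n < J1)%N -> majorant F z n <= d%:E.
  case: F zC => /= zC nJ1.
  - by rewrite lee_fin ltW// zd// leq_max nJ1.
  - rewrite lee_fin cesaro1_le_cst// => k kn.
    by rewrite ltW// zd// leq_max (leq_ltn_trans kn nJ1).
  - apply: ge_ereal_sup => _ [k/= nk <-].
    have [kJ|Jk] := ltnP k (maxn J1 J2); first by rewrite lee_fin ltW// zd.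
    apply: (@le_trans _ _ (C * cesaro_harmonic k)%:E).
      by apply: le_trans _ (zC k); apply: ereal_sup_ubound; exists k => /=.
    by rewrite lee_fin small// (leq_trans _ Jk)// leq_maxr.
pose f1 n : \bar R := if (n < J1)%N then d%:E else 0.
pose f2 n : \bar R := if (n < J1)%N then 0 else (C * cesaro_harmonic n)%:E.
have f10 n : 0 <= f1 n by rewrite /f1; case: ifP => // _; rewrite lee_fin ltW.
have f20 n : 0 <= f2 n by rewrite /f2; case: ifP => // _; rewrite lee_fin.
apply: (@le_lt_trans _ _ (lnorm q (fun n => f1 n + f2 n))).
  apply: le_lnorm => // n; first exact: majorant_ge0.
  by rewrite /f1 /f2; case: ifP => nJ; rewrite ?adde0 ?add0e ?head.
apply: le_lt_trans (lnormD (ltW q1) f10 f20) _.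
apply: (@le_lt_trans _ _ ((e / 3)%:E + (e / 3)%:E)).
  apply: leeD => //; apply: le_trans (lnorm_head _ (ltW q1) (ltW d0)) _.
  rewrite lee_fin [leRHS](_ : _ = J1.+1%:R * d)%R; last first.
    by rewrite [RHS]mulrC divfK.
  by rewrite ler_wpM2r ?ler_nat// ltW.
rewrite -EFinD lte_fin; lra.
Qed.

End bnorm_estimates.

(** * The inductive limit *)

Section lb_operators.
Context {R : realType} {E : lbseq R}.
Implicit Types (S : indlim E -> indlim E) (U : set (indlim E)) (L : nat -> R).

Definition lbounded L S := forall k x,
  (E k (ilval (S x)) <= (L k)%:E * E k (ilval x))%E.

Lemma linear_comb S (a b : R[i]) (x y : indlim E) : linear S ->
  S (a *: x + b *: y) = a *: S x + b *: S y.
Proof.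
move=> linS; rewrite linS; congr (_ + _).
have S0 : S 0 = 0.
  have := linS 1 0 0; rewrite !scale1r addr0 => /eqP.
  by rewrite -subr_eq subrr => /eqP.
by have := linS b y 0; rewrite S0 !addr0.
Qed.

(** At step k the radius e / L k serves the whole family at once, so the common preimage is again a
    basic neighbourhood. This is what gives equicontinuity. *)
Lemma ind_base_lbounded L (Fam : set (indlim E -> indlim E)) U :
  (forall k, 0 < L k) ->
  (forall S, Fam S -> linear S /\ lbounded L S) -> ind_base U ->
  ind_base [set x | forall S, Fam S -> U (S x)].
Proof.
move=> L0 FamL [aU bU]; split.
  move=> a b x y ab xU yU S FS; have [linS _] := FamL S FS.
  by rewrite linear_comb//; apply: aU => //; [exact: xU|exact: yU].
move=> k; have [e e0 eU] := bU k; exists (e / L k); first by rewrite divr_gt0.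
move=> x xe S FS; apply: eU; have [_ bS] := FamL S FS.
by apply: le_lt_trans (bS k x) _; rewrite muleC -lte_pdivlMr.
Qed.

Lemma equicontinuous_lbounded L (Fam : set (indlim E -> indlim E)) :
  (forall k, 0 < L k) ->
  (forall S, Fam S -> linear S /\ lbounded L S) ->
  equicontinuous (Fam : set (indlim E -> pointed_tvs (indlim E))) id.
Proof.
move=> L0 FamL x A [U [[V bV VU] UA]].
exists [set v | forall S, Fam S -> V (S v)].
  exact: ind_base_lbounded.
move=> v vV S FS; apply/set_mem/UA/mem_set; have [linS _] := FamL S FS.
have -> : ((S x, S (x + v)).1 - (S x, S (x + v)).2) = - S v :> indlim E.
  rewrite /= -[x in S (x + v)](scale1r x) linS scale1r opprD addrA.
  by rewrite subrr add0r.
rewrite -[- _]add0r; apply: VU.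
(* The entourage delivers the difference with the opposite sign; absolute convexity makes V
   symmetric. *)
have [aV _] := bV; have /= := aV (-1) 0 (S v) 0.
rewrite scaler0 addr0 scaleN1r; apply.
- by rewrite normrN1 normr0 addr0.
- exact: vV.
- exact: ind_base0.
Qed.

Lemma continuous_lbounded L S : (forall k, 0 < L k) -> linear S ->
  lbounded L S -> continuous S.
Proof.
move=> L0 linS bS x A [U bU UA].
exists [set v | forall S', [set S] S' -> U (S' v)].
  by apply: ind_base_lbounded bU; first exact: L0; move=> _ ->.
move=> v /(_ S erefl) vU; rewrite /= -(scale1r x) linS scale1r.
exact: UA.
Qed.

End lb_operators.

(** * Limits of bounded scalar functions along an ultrafilter *)

Section ultrafilter_limits.
Context {R : realType}.

Lemma ultra_real_limit T (G : set_system T) (f : T -> R) (a : R) :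
  UltraFilter G -> G [set x | `|f x| <= a] ->
  exists r, forall e, 0 < e -> G [set x | `|f x - r| < e].
Proof.
move=> GU Ga.
have [|r [_ rcl]] := @segment_compact R (- a) a (f @ G) _.
  change (G (f @^-1` `[- a, a])).
  by apply: filterS Ga => x /=; rewrite in_itv/= ler_norml.
exists r => e e0.
(* A cluster point is a limit: otherwise the complement of the preimage of the ball belongs to G,
   and its image would have to meet that ball. *)
have [//|Gn] := in_ultra_setVsetC [set x | `|f x - r| < e] GU.
have fGn : (f @ G) [set f x | x in ~` [set x | `|f x - r| < e]].
  by change (G (f @^-1` [set f x | x in ~` [set x | `|f x - r| < e]]));
    apply: filterS Gn => x xn; exists x.
have [_ [[x /= xn <-]]] := rcl _ _ fGn (nbhsx_ballx r e e0).
by rewrite /ball/= distrC => /xn.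
Qed.

Lemma ultra_complex_limit T (G : set_system T) (f : T -> R[i]) (a : R) :
  UltraFilter G -> G [set x | normc (f x) <= a] ->
  exists z, forall e, 0 < e -> G [set x | normc (z - f x) < e].
Proof.
move=> GU Ga.
have leRe (z : R[i]) : `|complex.Re z| <= normc z.
  by case: z => u v /=; rewrite -sqrtr_sqr ler_wsqrtr// lerDl sqr_ge0.
have leIm (z : R[i]) : `|complex.Im z| <= normc z.
  by case: z => u v /=; rewrite -sqrtr_sqr ler_wsqrtr// lerDr sqr_ge0.
have leReIm (z : R[i]) : normc z <= `|complex.Re z| + `|complex.Im z|.
  case: z => u v /=; rewrite -[leRHS]ger0_norm ?addr_ge0// -sqrtr_sqr.
  rewrite ler_wsqrtr// sqrrD !real_normK ?num_real// lerD2r lerDl.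
  by rewrite mulrn_wge0// mulr_ge0.
have [|u uG] := @ultra_real_limit T G (fun x => complex.Re (f x)) a GU.
  by apply: filterS Ga => x; exact: le_trans (leRe _).
have [|v vG] := @ultra_real_limit T G (fun x => complex.Im (f x)) a GU.
  by apply: filterS Ga => x; exact: le_trans (leIm _).
exists (u +i* v) => e e0; have e20 : 0 < e / 2 by rewrite divr_gt0.
apply: filterS (filterI (uG _ e20) (vG _ e20)) => x [/= ux vx].
apply: le_lt_trans (leReIm _) _.
rewrite [e]splitr; apply: ltrD.
  by move: ux; rewrite distrC; case: (f x).
by move: vx; rewrite distrC; case: (f x).
Qed.

End ultrafilter_limits.

(** * Neighbourhoods and compact sets in the inductive limit *)

Section lb_topology.
Context {R : realType} {F : seqfamily} {p : \bar R} {s : exponents p}.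
Local Notation X := (indlim (LB F s)).
Implicit Types (x y : X) (C c e : R).

(** The trace on X of a ball for the case q = oo, where the norm is the supremum of the majorant.
    That norm is below every step norm, so the trace is a neighbourhood of 0. *)
Definition ubox c : set X :=
  [set x | forall n, (majorant F (ilval x) n <= c%:E)%E].

Definition cbox C : set X :=
  [set x | forall n, (majorant F (ilval x) n <= (C * cesaro_harmonic n)%:E)%E].

Lemma expo_gt0 k : 0 < s k. Proof. exact: lt_trans (expo_gt1 s k). Qed.

Lemma ind_base_ubox c : 0 < c -> ind_base (ubox c).
Proof.
move=> c0; split.
  move=> a b x y ab xc yc n.
  have -> : ilval (a *: x + b *: y) = (a *: ilval x + b *: ilval y)%R by [].
  apply: le_trans (majorantD _ _ _ _) _.
  apply: (@le_trans _ _ ((normc a * c)%:E + (normc b * c)%:E)%E).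
    apply: leeD; (apply: le_trans (le_majorantZ _ _ _ _) _);
      rewrite EFinM lee_wpmul2l ?lee_fin ?normc_ge0//.
  rewrite -EFinD lee_fin -mulrDl ger_pMl//.
  by rewrite -lecR rmorphD.
move=> k; exists c => // x xc n.
exact/ltW/(le_lt_trans (majorant_le_bnorm F (ilval x) n (expo_gt0 k))).
Qed.

Lemma near_coord x n e : 0 < e ->
  \forall y \near x,
    forall k, (k <= n)%N -> normc (ilval x k - ilval y k) < e.
Proof.
(* Dividing by n + 1 absorbs the factor of [normc_le_majorant]; halving gives the strict
   inequality. *)
move=> e0; pose c := e / 2 / n.+1%:R.
have c0 : 0 < c by rewrite !divr_gt0.
exists (ubox c); first exact: ind_base_ubox.
move=> v vc k kn.
have -> : ilval x k - ilval (x + v) k = - ilval v k.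
  rewrite [ilval (x + v)](_ : _ = ilval x + ilval v)//=.
  by rewrite opprD addrA subrr add0r.
rewrite normcN; apply: (@le_lt_trans _ _ (e / 2)); last first.
  by rewrite gtr_pMr// invf_lt1// ltr1n.
rewrite -lee_fin; apply: le_trans (normc_le_majorant F (ilval v) k) _.
apply: (@le_trans _ _ (k.+1%:R%:E * c%:E)%E).
  by rewrite lee_wpmul2l ?lee_fin.
rewrite -EFinM lee_fin /c mulrC mulrAC ler_pdivrMr//.
by rewrite ler_wpM2l ?ler_nat// ltW// divr_gt0.
Qed.

Lemma closed_cbox C : closed (cbox C).
Proof.
move=> x clx; apply: majorant_closed => n e e0.
have [y [yC yx]] := clx _ (near_coord x n e0).
by exists (ilval y); split.
Qed.

Lemma cbox_lbset C (y : omega R) : 0 <= C ->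
  (forall n, (majorant F y n <= (C * cesaro_harmonic n)%:E)%E) ->
  y \in lbset (LB F s).
Proof.
move=> C0 yC; rewrite inE; exists 0%N => //=.
apply: le_lt_trans (bnorm_le_harmonic (expo_gt1 s 0) C0 yC) _.
by rewrite lte_mul_pinfty// lnorm_cesaro_harmonic// expo_gt1.
Qed.

(** A neighbourhood of 0 contains a ball of the first step, and on [cbox C] small coordinates force
    a small norm there. *)
Lemma cbox_nbhs0 C (A : set X) : 0 <= C -> nbhs (0 : X) A ->
  exists J, exists2 d, 0 < d & forall x, cbox C x ->
    (forall k, (k < J)%N -> normc (ilval x k) < d) -> A x.
Proof.
move=> C0 [U [_ /(_ 0%N)[e e0 eU]] UA].
have [J [d d0 Jd]] := bnorm_dominated F (expo_gt1 s 0) C0 e0.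
exists J, d => // x xC xd; rewrite -[x]add0r; apply: UA; apply: eU.
exact: Jd.
Qed.

(** Along an ultrafilter on the box the bounded coordinates converge; the limit sequence satisfies
    the same majorant bound, and [cbox_nbhs0] upgrades coordinatewise convergence to convergence in
    X. *)
Lemma compact_cbox C : 0 <= C -> compact (cbox C).
Proof.
move=> C0; rewrite compact_ultra => G GU GC.
have lim k : {z | forall e, 0 < e -> G [set x : X | normc (z - ilval x k) < e]}.
  apply: cid; apply: (@ultra_complex_limit _ _ _ (fun x : X => ilval x k)
    (k.+1%:R * (C * cesaro_harmonic k))).
  apply: filterS GC => x xC /=; rewrite -lee_fin.
  apply: le_trans (normc_le_majorant F (ilval x) k) _.
  by rewrite EFinM lee_wpmul2l ?lee_fin//; exact: xC.
pose y k := sval (lim k).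
have yG n e : 0 < e ->
    G [set x : X | forall k, (k <= n)%N -> normc (y k - ilval x k) < e].
  move=> e0; elim: n => [|n ih].
    by apply: filterS (svalP (lim 0%N) e e0) => x /= xe [|].
  apply: filterS (filterI ih (svalP (lim n.+1) e e0)) => x [/= xn xe] k.
  by rewrite leq_eqVlt => /orP[/eqP ->//|]; rewrite ltnS; exact: xn.
have yC : forall n, (majorant F y n <= (C * cesaro_harmonic n)%:E)%E.
  apply: majorant_closed => n e e0.
  have [x [/= xn xC]] := filter_ex (filterI (yG n e e0) GC).
  by exists (ilval x); split.
pose y' : X := IndLim (cbox_lbset C0 yC).
exists y'; split => //= A Ay.
have A0 : nbhs (0 : X) [set v | A (y' + v)].
  by have [U bU UA] := Ay; exists U => // v Uv /=; rewrite add0r; exact: UA.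
(* The difference of two elements of [cbox C] lies in [cbox (2 * C)]. *)
have C20 : 0 <= 2 * C by rewrite mulr_ge0.
have [J [d d0 Jd]] := cbox_nbhs0 C20 A0.
apply: filterS (filterI (yG J d d0) GC) => x [/= xJ xC].
have -> : x = y' + (x - y') by rewrite addrC subrK.
apply: Jd => [n|k kJ]; last first.
  rewrite [ilval (x - y')](_ : _ = ilval x - y)//= -normcN opprB.
  by apply: xJ; exact: ltnW.
rewrite [ilval (x - y')](_ : _ = ilval x + (-1) *: y); last first.
  by rewrite scaleN1r.
apply: le_trans (majorantD _ _ _ _) _.
rewrite -mulrA mulrDl !mul1r EFinD; apply: leeD; first exact: xC.
apply: le_trans (le_majorantZ _ _ _ _) _.
by rewrite normcN normc1 mul1e.
Qed.

End lb_topology.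
Arguments expo_gt0 {R p} s k.

(** * The Cesaro recursion *)

Section cesaro_algebra.
Context {K : numFieldType}.
Implicit Types (t l a : K) (x y z : nat -> K) (m n : nat).

Lemma seq_addE x y n : (x + y) n = x n + y n. Proof. by []. Qed.

Lemma seq_scaleE a x n : (a *: x) n = a * x n. Proof. by []. Qed.

Lemma cesaro_op0 t x : cesaro_op t x 0 = x 0%N.
Proof. by rewrite /cesaro_op big_ord1 expr0 mul1r divr1. Qed.

Lemma cesaro_opS t x n : n.+2%:R * cesaro_op t x n.+1 =
  x n.+1 + t * (n.+1%:R * cesaro_op t x n).
Proof.
rewrite /cesaro_op !(mulrC _%:R) !divfK ?pnatr_eq0// big_ord_recr/=.
rewrite subnn expr0 mul1r addrC; congr (_ + _).
rewrite mulr_sumr; apply: eq_bigr => i _.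
by rewrite subSn -1?ltnS// exprS mulrA.
Qed.

Lemma cesaro_op_linear t a x y :
  cesaro_op t (a *: x + y) = a *: cesaro_op t x + cesaro_op t y.
Proof.
apply/funext => n; rewrite seq_addE seq_scaleE /cesaro_op.
rewrite mulrA -mulrDl mulr_sumr -big_split/=; congr (_ / _).
by apply: eq_bigr => i _; rewrite seq_addE seq_scaleE mulrDr mulrCA.
Qed.

(** C_t is lower triangular with diagonal entries 1 / (n + 1), so the first nonzero coordinate of an
    eigenvector determines the eigenvalue. *)
Lemma cesaro_eigen_eq0 t l x : (forall n, l * x n = cesaro_op t x n) ->
  (forall n, l = n.+1%:R^-1 -> x n = 0) -> forall n, x n = 0.
Proof.
move=> lx x0; elim/ltn_ind => n ih.
have [/x0//|ln] := eqVneq l n.+1%:R^-1.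
have : (l - n.+1%:R^-1) * x n = 0.
  rewrite mulrBl lx /cesaro_op big_ord_recr/= subnn expr0 mul1r big1 ?add0r.
    by rewrite mulrC subrr.
  by move=> i _; rewrite ih ?mulr0.
by move/eqP; rewrite mulf_eq0 subr_eq0 (negbTE ln) => /eqP.
Qed.

(* The equation satisfied by [z = C_t x] when [l x - C_t x = y], obtained by
   applying to it C_t^-1 : z |-> ((n + 1) z_n - t n z_{n-1})_n. *)
Definition image_eq t l y z n := (l * n.+1%:R - 1) * z n =
  y n + (if n is m.+1 then l * t * m.+1%:R * z m else 0).

(* Since 1 / 0 = 0, this vanishes at [n = m] if [l = 1 / (m + 1)]. *)
Fixpoint image_sol t l y n : K :=
  (y n + (if n is m.+1 then l * t * m.+1%:R * image_sol t l y m else 0)) /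
  (l * n.+1%:R - 1).

Lemma image_solE t l y n : image_sol t l y n =
  (y n + (if n is m.+1 then l * t * m.+1%:R * image_sol t l y m else 0)) /
  (l * n.+1%:R - 1).
Proof. by case: n. Qed.

Lemma eigenvalue_eq l n : (l * n.+1%:R - 1 == 0) = (l == n.+1%:R^-1).
Proof.
have n0 : n.+1%:R != 0 :> K by rewrite pnatr_eq0.
rewrite subr_eq0; apply/eqP/eqP => [|->]; last by rewrite mulVf.
by move=> /(congr1 (fun u => u / n.+1%:R)); rewrite mulfK// mul1r.
Qed.

Lemma image_sol_eq t l y n : l != n.+1%:R^-1 ->
  image_eq t l y (image_sol t l y) n.
Proof.
rewrite -eigenvalue_eq => ln.
by rewrite /image_eq [in LHS]image_solE mulrC divfK.
Qed.

(** Forward substitution. The condition on l stops at n, so that for l = 1 / (m + 1) the values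
    before index m are still determined. *)
Lemma image_eq_uniq t l y z n : (forall k, image_eq t l y z k) ->
  (forall k, (k <= n)%N -> l != k.+1%:R^-1) -> z n = image_sol t l y n.
Proof.
move=> yz; elim: n => [|n ih] ln.
  apply: (@mulfI _ (l * 1%:R - 1)); first by rewrite eigenvalue_eq ln.
  by rewrite yz image_sol_eq// ln.
apply: (@mulfI _ (l * n.+2%:R - 1)); first by rewrite eigenvalue_eq ln.
by rewrite yz image_sol_eq ?ln// ih// => k kn; apply: ln; exact: leqW.
Qed.

Lemma image_eq_cesaro t l x y : (forall n, l * x n - cesaro_op t x n = y n) ->
  forall n, image_eq t l y (cesaro_op t x) n.
Proof.
move=> lxy; case=> [|n]; rewrite /image_eq -lxy.
  by rewrite cesaro_op0 mulr1 addr0 mulrBl mul1r.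
transitivity (l * (n.+2%:R * cesaro_op t x n.+1) - cesaro_op t x n.+1).
  by ring.
by rewrite cesaro_opS; ring.
Qed.

(** Converse of [image_eq_cesaro]: a solution z of the recursion really is C_t x for x = (y + z) /
    l, hence l x - C_t x = y. *)
Lemma cesaro_of_image_eq t l y z : l != 0 ->
  (forall n, image_eq t l y z n) ->
  cesaro_op t (l^-1 *: (y + z)) = z.
Proof.
move=> l0 yz; apply/funext.
set x := l^-1 *: _; have xE n : l * x n = y n + z n.
  by rewrite /x seq_scaleE seq_addE mulrA divff// mul1r.
elim=> [|n ih]; apply: (mulfI l0).
  rewrite cesaro_op0 xE; have := yz 0%N; rewrite /image_eq mulr1 addr0 => <-.
  ring.
have n0 : n.+2%:R != 0 :> K by rewrite pnatr_eq0.
apply: (mulfI n0); rewrite mulrCA cesaro_opS ih mulrDr xE.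
have := yz n.+1; rewrite /image_eq => yzn.
rewrite addrAC [l * (t * _)](_ : _ = l * t * n.+1%:R * z n); last first.
  by rewrite !mulrA.
rewrite -yzn; ring.
Qed.

Lemma image_sol_linear t l a y y' :
  image_sol t l (a *: y + y') = a *: image_sol t l y + image_sol t l y'.
Proof.
have solS u n : image_sol t l u n.+1 =
    (u n.+1 + l * t * n.+1%:R * image_sol t l u n) / (l * n.+2%:R - 1) by [].
apply/funext; elim=> [|n ih]; rewrite seq_addE seq_scaleE.
  by rewrite /= !addr0 seq_addE seq_scaleE mulrDl mulrA.
rewrite !solS ih !seq_addE !seq_scaleE; ring.
Qed.

Lemma eigenseq_diag t m a : eigenseq t m a m = a.
Proof.
by rewrite /eigenseq ltnn subnn fact0 expr0 !mulr1 divff ?mulr1//.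
Qed.

(* For [l = 1 / (m + 1)] the [m]-th equation reads [0 = defect t m y]; it is the
   only obstruction to solving [l x - C_t x = y]. *)
Definition defect t m y := y m +
  (if m is k.+1 then m.+1%:R^-1 * t * k.+1%:R * image_sol t m.+1%:R^-1 y k
   else 0).

Lemma defect_linear t m a y y' :
  defect t m (a *: y + y') = a * defect t m y + defect t m y'.
Proof.
rewrite /defect seq_addE seq_scaleE; case: m => [|m]; first by rewrite !addr0.
rewrite image_sol_linear seq_addE seq_scaleE; ring.
Qed.

Lemma eigenvalue_neq m k : k != m -> m.+1%:R^-1 != k.+1%:R^-1 :> K.
Proof. by move=> km; rewrite (inj_eq invr_inj) eqr_nat eqSS eq_sym. Qed.

(** The equation of index m becomes 0 = 0 and leaves z_m free, so the value 0 produced by the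
    division by 0 is admissible. *)
Lemma image_sol_defect t m y : defect t m y = 0 ->
  forall n, image_eq t m.+1%:R^-1 y (image_sol t m.+1%:R^-1 y) n.
Proof.
move=> ym n; have [->|nm] := eqVneq n m; last exact/image_sol_eq/eigenvalue_neq.
by rewrite /image_eq mulVf ?pnatr_eq0// subrr mul0r; exact/esym.
Qed.

Lemma defect_eq0 t m y z : (forall n, image_eq t m.+1%:R^-1 y z n) ->
  defect t m y = 0.
Proof.
move=> yz; have := yz m; rewrite /image_eq mulVf ?pnatr_eq0// subrr mul0r.
move=> yzm; rewrite [RHS]yzm /defect; congr (_ + _).
case: m yz {yzm} => [//|m] yz; congr (_ * _).
apply/esym/image_eq_uniq => // k km; apply: eigenvalue_neq.
by rewrite neq_ltn ltnS km.
Qed.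

(** The sequence vanishes before m, and so does the recursion solution. The eigenvector can
    therefore represent the quotient by the range. *)
Lemma defect_eigenseq t m : defect t m (eigenseq t m 1) = 1.
Proof.
rewrite /defect eigenseq_diag; case: m => [|m]; first by rewrite addr0.
suff -> : image_sol t m.+2%:R^-1 (eigenseq t m.+1 1) m = 0.
  by rewrite mulr0 addr0.
suff : forall k, (k <= m)%N ->
    image_sol t m.+2%:R^-1 (eigenseq t m.+1 1) k = 0 by apply.
elim=> [|k ih] km; rewrite image_solE /eigenseq ltnS km add0r ?mul0r//.
by rewrite [image_sol _ _ _ k]ih ?mulr0 ?mul0r// ltnW.
Qed.

Lemma eigenseq_rec t m a n : n.+1%:R * eigenseq t m a (m + n).+1 =
  t * (m + n).+1%:R * eigenseq t m a (m + n).
Proof.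
have f0 k : k`!%:R != 0 :> K by rewrite pnatr_eq0 -lt0n fact_gt0.
rewrite /eigenseq !ltnNge -addnS !leq_addr/= !(addKn, subSn)//= addnS.
rewrite !factS !natrM exprS.
by field; rewrite ?f0 nat1r ?pnatr_eq0.
Qed.

Lemma eigenseqZ t m a : eigenseq t m a = a *: eigenseq t m 1.
Proof.
apply/funext => n; rewrite seq_scaleE /eigenseq.
by case: ifP => _; rewrite ?mulr0// mul1r.
Qed.

Lemma cesaro_eigenseq t m a :
  cesaro_op t (eigenseq t m a) = m.+1%:R^-1 *: eigenseq t m a.
Proof.
have m0 : m.+1%:R^-1 != 0 :> K by rewrite invr_eq0 pnatr_eq0.
(* Writing x as (0 + l x) / l with l = 1 / (m + 1) reduces the claim to the recursion for z = l x
   and y = 0. *)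
rewrite [in LHS](_ : eigenseq t m a = m.+1%:R^-1^-1 *:
    ((0 : nat -> K) + m.+1%:R^-1 *: eigenseq t m a)); last first.
  by rewrite add0r scalerA mulVf// scale1r.
rewrite cesaro_of_image_eq// => n.
set v := _ *: _; have vE k : v k = m.+1%:R^-1 * eigenseq t m a k by [].
have v0 k : (k < m)%N -> v k = 0 by rewrite vE /eigenseq => ->; rewrite mulr0.
rewrite /image_eq [(0 : nat -> K) n](_ : _ = 0)// add0r.
have [nm|mn] := ltnP n m.
  by rewrite v0// mulr0; case: n nm => // k km; rewrite v0 ?mulr0// ltnW.
have [->|nm] := eqVneq n m.
  rewrite mulVf ?subrr ?mul0r ?pnatr_eq0//.
  by case: (m) v0 => // k ->; rewrite ?mulr0.
have {mn nm} [k ->] : exists k, n = (m + k).+1.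
  by exists (n - m).-1; lia.
rewrite !vE; have := eigenseq_rec t m a k.
move: (eigenseq _ _ _ _) (eigenseq _ _ _ _) => u w uw.
have -> : m.+1%:R^-1 * (m + k).+2%:R - 1 = m.+1%:R^-1 * k.+1%:R :> K.
  rewrite (_ : (m + k).+2 = m.+1 + k.+1)%N; last by rewrite addSn addnS.
  by rewrite natrD mulrDr mulVf ?pnatr_eq0// addrAC subrr add0r.
by rewrite mulrACA uw; ring.
Qed.

End cesaro_algebra.

(** * Growth of the solutions *)

Section resolvent_estimates.
Context {R : realType}.
Implicit Types (t r c d : R) (l mu z : R[i]) (x y : omega R) (n m : nat).

(** If all multipliers were at most r, e would be bounded by B times the convolution of g with r^k.
    Each of the first N steps costs an extra factor A / r. *)
Lemma geometric_growth r A B N (e g a : nat -> R) : 0 < r -> r <= A ->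
  0 <= B -> (forall n, 0 <= e n) -> (forall n, 0 <= g n) ->
  e 0%N <= B * g 0%N -> (forall n, e n.+1 <= B * g n.+1 + a n * e n) ->
  (forall n, a n <= A) -> (forall n, (N <= n)%N -> a n <= r) ->
  forall n, e n <= B * (A / r) ^+ N * \sum_(i < n.+1) r ^+ (n - i) * g i.
Proof.
move=> r0 rA B0 e0 g0 eg0 eg aA ar n.
(* P n collects the extra factors spent up to index n. *)
pose P n := (A / r) ^+ minn n N; pose S n := \sum_(i < n.+1) r ^+ (n - i) * g i.
have A1 : 1 <= A / r by rewrite ler_pdivlMr// mul1r.
have P1 k : 1 <= P k by rewrite exprn_ege1.
have SS k : S k.+1 = g k.+1 + r * S k.
  rewrite /S big_ord_recr/= subnn mul1r addrC mulr_sumr; congr (_ + _).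
  by apply: eq_bigr => i _; rewrite subSn -1?ltnS// exprS mulrA.
have S0 k : 0 <= S k.
  by apply: sumr_ge0 => i _; rewrite mulr_ge0// exprn_ge0// ltW.
suff eP : e n <= B * P n * S n.
  apply: le_trans eP _; rewrite ler_wpM2r// ler_wpM2l// ler_weXn2l//.
  exact: geq_minr.
elim: n => [|n ih].
  by rewrite /P /S big_ord1 min0n !expr0 mulr1 mul1r.
apply: le_trans (eg n) _; rewrite SS.
have step : a n * P n <= P n.+1 * r.
  have [nN|Nn] := ltnP n N.
    have -> : P n.+1 = P n * (A / r).
      by rewrite /P (minn_idPl nN) (minn_idPl (ltnW nN)) exprSr.
    rewrite -mulrA divfK ?gt_eqF// [leRHS]mulrC ler_wpM2r//.
    exact: le_trans (P1 n).
  have -> : P n.+1 = P n by rewrite /P !(minn_idPr _)// leqW.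
  by rewrite mulrC ler_wpM2l ?ar//; exact: le_trans (P1 n).
have P0 : 0 <= P n by exact: le_trans (P1 n).
have ae : a n * e n <= B * P n.+1 * (r * S n).
  have [a0|a0] := leP 0 (a n); last first.
    apply: (@le_trans _ _ 0); first by rewrite mulr_le0_ge0// ltW.
    by rewrite !mulr_ge0 ?(ltW r0)// (le_trans _ (P1 n.+1)).
  apply: le_trans (ler_wpM2l a0 ih) _.
  rewrite !mulrA (mulrC (a n)) -!mulrA ler_wpM2l// !mulrA ler_wpM2r//.
rewrite mulrDr lerD// ler_wpM2r// ler_peMr//.
Qed.

Lemma normc_real t : normc t%:C = `|t|.
Proof. by rewrite /= expr0n/= addr0 sqrtr_sqr. Qed.

Lemma normc_nat n : normc (n%:R : R[i]) = n%:R.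
Proof. by rewrite -(rmorph_nat (real_complex R)) normc_real ger0_norm. Qed.

Lemma normcX z n : normc (z ^+ n) = normc z ^+ n.
Proof. by elim: n => [|n ih]; rewrite ?normc1// !exprS normcM ih. Qed.

Lemma normcB_ge l mu : normc l - normc mu <= normc (l - mu).
Proof.
rewrite lerBlDr; apply: le_trans _ (le_normcD _ _).
by rewrite subrK.
Qed.

Lemma normc_gt0 l : (0 < normc l) = (l != 0).
Proof.
rewrite lt_neqAle normc_ge0 andbT eq_sym; congr (~~ _).
by apply/eqP/eqP => [/eq0_normc//|->]; exact: normc0.
Qed.

Lemma normc_sum I (s : seq I) (f : I -> R[i]) :
  normc (\sum_(i <- s) f i) <= \sum_(i <- s) normc (f i).
Proof.
elim: s => [|i s ih]; first by rewrite !big_nil normc0.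
rewrite !big_cons; apply: le_trans (le_normcD _ _) _.
by rewrite lerD2l.
Qed.

Lemma normc_cesaro t x n : 0 <= t ->
  normc (cesaro_op t%:C x n) <= cesaro_op t (fun k => normc (x k)) n.
Proof.
move=> t0; rewrite /cesaro_op normcM normcV normc_nat ler_wpM2r//.
apply: le_trans (normc_sum _ _) _; apply: ler_sum => i _.
by rewrite normcM normcX normc_real ger0_norm.
Qed.

(** For large n the point 1 / (n + 1) is within |l| / 2 of 0, hence at least |l| / 2 away from l;
    finitely many points remain. Excluding l itself lets the lemma apply at eigenvalues too. *)
Lemma Lambda_gap l : l != 0 -> exists2 d, 0 < d &
  forall n, l != n.+1%:R^-1 -> d <= normc (l - n.+1%:R^-1).
Proof.
move=> l0; have nl0 : 0 < normc l / 2 by rewrite divr_gt0// normc_gt0.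
have [N] := ltr_add_invr nl0; rewrite add0r => Nl.
have [d d0 dN] : exists2 d, 0 < d & forall n, (n < N)%N ->
    l != n.+1%:R^-1 -> d <= normc (l - n.+1%:R^-1).
  elim: N {Nl} => [|N [d d0 ih]]; first by exists 1.
  have [lN|lN] := eqVneq l N.+1%:R^-1.
    exists d => // n; rewrite ltnS leq_eqVlt => /orP[/eqP ->|/ih//].
    by rewrite lN eqxx.
  exists (Num.min d (normc (l - N.+1%:R^-1))).
    by rewrite lt_min d0 normc_gt0 subr_eq0.
  move=> n; rewrite ltnS leq_eqVlt ge_min => /orP[/eqP -> _|nN /ih ->//].
  by rewrite lexx orbT.
exists (Num.min d (normc l / 2)); first by rewrite lt_min d0.
move=> n ln; rewrite ge_min; have [nN|Nn] := ltnP n N.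
  by rewrite dN.
apply/orP; right; apply: le_trans _ (normcB_ge _ _).
rewrite normcV normc_nat lerBrDr.
apply: (@le_trans _ _ (normc l / 2 + normc l / 2)).
  rewrite lerD2l; apply: le_trans _ (ltW Nl).
  by rewrite lef_pV2 ?posrE// ler_nat.
by rewrite -splitr.
Qed.

(** For e_n = (n + 1) |z_n| and b_n = 1 / |mu - 1 / (n + 1)| the recursion gives e_{n+1} <= b_{n+1}
    |y_{n+1}| + b_{n+1} |mu| t e_n, whose multipliers tend to t uniformly in mu. When mu = 1 / (n +
    1), inverting 0 makes b_n = 0, so the estimate survives. *)
Lemma image_sol_bound t c d L : 0 <= t -> t < 1 -> 0 < c -> 0 < d -> 0 <= L ->
  exists K r, [/\ 0 <= K, 0 <= r, r < 1 & forall mu,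
    c <= normc mu -> normc mu <= L ->
    (forall n, mu != n.+1%:R^-1 -> d <= normc (mu - n.+1%:R^-1)) ->
    forall y n, normc (image_sol t%:C mu y n) <=
      K * cesaro_op r (fun k => normc (y k)) n].
Proof.
move=> t0 t1 c0 d0 L0; pose r := (1 + t) / 2.
have r0 : 0 < r by rewrite /r; lra.
have r1 : r < 1 by rewrite /r; lra.
have tc0 : 0 < (1 - t) / 2 * c by rewrite mulr_gt0//; lra.
(* From N on, 1 / (n + 2) <= (r - t) |mu|, whence t |mu| <= r (|mu| - 1 / (n + 2)); N depends on c
   and t only. *)
have [N] := ltr_add_invr tc0; rewrite add0r => Ntc.
pose A := r + L * t / d; have rA : r <= A.
  by rewrite lerDl divr_ge0 ?mulr_ge0 ?(ltW d0).
exists (d^-1 * (A / r) ^+ N), r; split => //.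
- rewrite mulr_ge0 ?invr_ge0 ?(ltW d0)// exprn_ge0// divr_ge0 ?(ltW r0)//.
  exact: le_trans (ltW r0) rA.
- exact: ltW.
move=> mu cmu muL mud y n.
pose b n := n.+1%:R * normc ((mu * n.+1%:R - 1)^-1) : R.
have bE k : mu != k.+1%:R^-1 -> b k = (normc (mu - k.+1%:R^-1))^-1.
  move=> muk; rewrite /b.
  have -> : mu * k.+1%:R - 1 = k.+1%:R * (mu - k.+1%:R^-1).
    by rewrite mulrBr mulfV ?pnatr_eq0// mulrC.
  by rewrite normcV normcM normc_nat invfM mulrA mulfV ?mul1r ?pnatr_eq0.
have b0 k : mu = k.+1%:R^-1 -> b k = 0.
  by rewrite /b => ->; rewrite mulVf ?pnatr_eq0// subrr invr0 normc0 mulr0.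
have b_ge0 k : 0 <= b k by rewrite /b mulr_ge0 ?normc_ge0.
have b_le k : b k <= d^-1.
  have [/b0 ->|muk] := eqVneq mu k.+1%:R^-1; first by rewrite invr_ge0 ltW.
  by rewrite bE// lef_pV2 ?posrE ?mud// (lt_le_trans d0)// mud.
pose z := image_sol t%:C mu y.
rewrite /cesaro_op mulrA ler_pdivlMr// [leLHS]mulrC.
have H := @geometric_growth r A d^-1 N (fun n => n.+1%:R * normc (z n))
  (fun n => normc (y n)) (fun n => b n.+1 * (normc mu * t)).
apply: (H r0 rA _ _ _ _ _ _ _ n).
- by rewrite invr_ge0 ltW.
- by move=> k; rewrite mulr_ge0 ?normc_ge0.
- by move=> k; exact: normc_ge0.
- rewrite /z image_solE addr0 normcM mulrCA mulrC ler_wpM2r ?normc_ge0//.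
  exact: b_le.
- move=> k; rewrite /z image_solE -/z normcM mulrCA mulrC -/(b k.+1).
  apply: le_trans (ler_wpM2l (b_ge0 _) (le_normcD _ _)) _.
  rewrite mulrDr lerD//; first by rewrite ler_wpM2r ?normc_ge0// b_le.
  rewrite !normcM normc_nat normc_real ger0_norm//.
  by rewrite !mulrA.
- move=> k; rewrite mulrC; apply: (@le_trans _ _ (L * t / d)).
    by rewrite ler_pM ?mulr_ge0 ?normc_ge0 ?ler_wpM2r ?b_le.
  by rewrite lerDr ltW.
- move=> k Nk; have [/b0 ->|muk] := eqVneq mu k.+2%:R^-1.
    by rewrite mul0r ltW.
  have gap := lt_le_trans d0 (mud _ muk).
  rewrite bE// ler_pdivrMl//.
  apply: (@le_trans _ _ ((normc mu - k.+2%:R^-1) * r)); last first.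
    rewrite ler_wpM2r ?(ltW r0)//; apply: le_trans _ (normcB_ge _ _).
    by rewrite normcV normc_nat.
  have kc : k.+2%:R^-1 <= (1 - t) / 2 * normc mu.
    apply: (@le_trans _ _ ((1 - t) / 2 * c)); last first.
      by rewrite ler_wpM2l//; lra.
    apply: le_trans _ (ltW Ntc).
    by rewrite lef_pV2 ?posrE// ler_nat ltnS leqW.
  have kr : k.+2%:R^-1 * r <= k.+2%:R^-1 by rewrite ler_piMr// ltW.
  have : 0 <= normc mu by exact: normc_ge0.
  rewrite mulrBl; move: (normc mu) (k.+2%:R^-1) kc kr => u h.
  rewrite /r => kc kr u0; nra.
Qed.

Lemma normc_le0 l : (normc l <= 0) = (l == 0).
Proof. by rewrite leNgt normc_gt0 negbK. Qed.

Lemma image_sol_coord_bound (a : R[i]) mu n : exists2 B, 0 <= B & forall y e,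
  (forall k, (k <= n)%N -> normc (y k) <= e) ->
  normc (image_sol a mu y n) <= B * e.
Proof.
elim: n => [|n [B B0 ih]].
  exists (normc ((mu * 1%:R - 1)^-1)); first by rewrite normc_ge0.
  move=> y e ye; rewrite image_solE addr0 normcM mulrC.
  by rewrite ler_wpM2l ?normc_ge0 ?ye.
exists (normc ((mu * n.+2%:R - 1)^-1) * (1 + normc (mu * a * n.+1%:R) * B)).
  by rewrite mulr_ge0 ?normc_ge0// addr_ge0// mulr_ge0 ?normc_ge0.
move=> y e ye; rewrite image_solE normcM mulrC -[leRHS]mulrA.
rewrite ler_wpM2l ?normc_ge0//; apply: le_trans (le_normcD _ _) _.
rewrite mulrDl mul1r lerD ?ye// normcM -[leRHS]mulrA ler_wpM2l ?normc_ge0//.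
by apply: ih => k kn; rewrite ye// leqW.
Qed.

(** The defect is controlled by the coordinates up to m, which vary continuously on X; this makes
    the range closed. *)
Lemma defect_bound (a : R[i]) m : exists2 B, 0 <= B & forall y e,
  (forall k, (k <= m)%N -> normc (y k) <= e) ->
  normc (defect a m y) <= B * e.
Proof.
case: m => [|m].
  by exists 1 => // y e ye; rewrite /defect addr0 mul1r ye.
have [B B0 yB] := image_sol_coord_bound a m.+2%:R^-1 m.
exists (1 + normc (m.+2%:R^-1 * a * m.+1%:R) * B).
  by rewrite addr_ge0// mulr_ge0 ?normc_ge0.
move=> y e ye; apply: le_trans (le_normcD _ _) _.
rewrite mulrDl mul1r lerD ?ye// normcM -[leRHS]mulrA ler_wpM2l ?normc_ge0//.
by apply: yB => k km; rewrite ye// leqW.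
Qed.

Lemma eigenseq_bound t m (a : R[i]) : 0 <= t -> t < 1 ->
  exists K r, [/\ 0 <= K, 0 <= r, r < 1 &
    forall n, normc (eigenseq t%:C m a n) <= K * r ^+ n].
Proof.
move=> t0 t1; pose r := (1 + t) / 2.
have r0 : 0 < r by rewrite /r; lra.
have r1 : r < 1 by rewrite /r; lra.
(* Consecutive coordinates have ratio t (m + k + 1) / (k + 1). It is at most r once (r - t) (k + 1)
   >= m + 1, and always at most t (m + 1). *)
have rt0 : 0 < (r - t) / m.+1%:R by rewrite divr_gt0// /r; lra.
have [N] := ltr_add_invr rt0; rewrite add0r => Nrt.
pose A := r + t * m.+1%:R; have rA : r <= A by rewrite lerDl mulr_ge0.
pose B := normc a * (A / r) ^+ N.
have B0 : 0 <= B.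
  rewrite mulr_ge0 ?normc_ge0// exprn_ge0// divr_ge0 ?(ltW r0)//.
  exact: le_trans (ltW r0) rA.
exists (B / r ^+ m), r; split => //; [|exact: ltW|].
  by rewrite divr_ge0// exprn_ge0// ltW.
pose e n := normc (eigenseq t%:C m a (m + n)).
have eB n : e n <= B * r ^+ n.
  (* The source is the unit mass at 0, so the convolution reduces to r^n. *)
  have := @geometric_growth r A (normc a) N e (fun n => (n == 0%N)%:R)
    (fun n => t * (m + n).+1%:R / n.+1%:R) r0 rA (normc_ge0 a).
  move=> H; apply: le_trans (H _ _ _ _ _ _ n) _.
  - by move=> k; exact: normc_ge0.
  - by move=> k; exact: ler0n.
  - by rewrite /e addn0 eigenseq_diag mulr1.
  - move=> k; rewrite mulr0 add0r mulrAC ler_pdivlMr// mulrC /e addnS.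
    rewrite -{1}(normc_nat k.+1) -normcM eigenseq_rec !normcM normc_nat.
    by rewrite normc_real ger0_norm.
  - move=> k; apply: (@le_trans _ _ (t * m.+1%:R)); last by rewrite lerDr ltW.
    rewrite -mulrA ler_wpM2l// ler_pdivrMr// -natrM ler_nat.
    by rewrite mulSn mulnS; lia.
  - move=> k Nk; rewrite ler_pdivrMr//.
    have mk : m.+1%:R <= (r - t) * k.+1%:R.
      apply: (@le_trans _ _ ((r - t) * N.+1%:R)).
        rewrite mulrC -ler_pdivrMr; last by rewrite /r; lra.
        rewrite -[leRHS]invrK -[leLHS]invrK.
        rewrite lef_pV2 ?posrE ?invr_gt0 ?divr_gt0//.
          by rewrite invf_div ltW.
        by rewrite /r; lra.
      by rewrite ler_wpM2l ?ler_nat//; rewrite /r; lra.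
    have tm : t * m%:R <= m.+1%:R.
      by apply: (@le_trans _ _ m%:R); rewrite ?ler_nat// ler_piMl// ltW.
    rewrite -addnS natrD mulrDr; lra.
  rewrite ler_wpM2l// big_ord_recl/= subn0 mulr1 big1 ?addr0// => i _.
  by rewrite mulr0.
move=> n; have [nm|mn] := ltnP n m.
  rewrite /eigenseq nm normc0 mulr_ge0 ?exprn_ge0 ?(ltW r0)//.
  by rewrite divr_ge0// exprn_ge0// ltW.
rewrite -{1}(subnKC mn); apply: le_trans (eB _) _.
by rewrite -(mulrA B) ler_wpM2l// mulrC expfB_cond// (gt_eqF r0).
Qed.

End resolvent_estimates.

(** * The generalized Cesaro operator *)

Section generalized_cesaro.
Context {R : realType} {F : seqfamily} {p : \bar R} {s : exponents p}.
Local Notation X := (indlim (LB F s)).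
Implicit Types (t c d r : R) (l mu : R[i]) (n m k : nat).

Lemma ilval_ext (x y : X) : (forall n, ilval x n = ilval y n) -> x = y.
Proof. by move=> xy; apply: val_inj; apply/funext. Qed.

Definition harmonic_norm k : R :=
  fine (lnorm (s k) (EFin \o cesaro_harmonic)).

Lemma harmonic_normE k :
  (harmonic_norm k)%:E = lnorm (s k) (EFin \o cesaro_harmonic).
Proof.
rewrite fineK// ge0_fin_numE ?lnorm_ge0//.
exact/lnorm_cesaro_harmonic/expo_gt1.
Qed.

Lemma harmonic_norm_ge0 k : 0 <= harmonic_norm k.
Proof. by rewrite -lee_fin harmonic_normE lnorm_ge0. Qed.

Lemma bnorm_cesaro r K k (x z : omega R) : 0 <= r -> r < 1 -> 0 <= K ->
  (forall n, normc (z n) <= K * cesaro_op r (fun k => normc (x k)) n) ->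
  (bnorm F (s k) z <=
   (K / (1 - r) * harmonic_norm k + 1)%:E * bnorm F (s k) x)%E.
Proof.
move=> r0 r1 K0 zK.
have c0 : 0 <= K / (1 - r) by rewrite divr_ge0// subr_ge0 ltW.
have L0 : 0 < K / (1 - r) * harmonic_norm k + 1.
  by rewrite ltr_wpDl// mulr_ge0// harmonic_norm_ge0.
(* The summand 1 keeps the constant positive even for K = 0, so an infinite norm of x gives an
   infinite right-hand side. *)
have [->|xoo] := eqVneq (bnorm F (s k) x) +oo%E.
  by rewrite gt0_muley ?leey.
have /fineK xE : bnorm F (s k) x \is a fin_num.
  by rewrite ge0_fin_numE ?bnorm_ge0// ltey.
set b := fine _ in xE.
have b0 : 0 <= b by rewrite -lee_fin xE bnorm_ge0.
have xb n : (majorant F x n <= b%:E)%E.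
  by rewrite xE; exact/majorant_le_bnorm/expo_gt0.
have zb := majorant_cesaro r0 r1 K0 xb zK.
apply: le_trans (bnorm_le_harmonic (expo_gt1 s k) _ zb) _.
  by rewrite mulr_ge0.
rewrite -harmonic_normE -xE -!EFinM lee_fin.
by rewrite (mulrC b) mulrAC [leRHS]mulrDl mul1r lerDl.
Qed.

Lemma lift_operator (A : omega R -> omega R) (L : nat -> R) :
  (forall (a : R[i]) (x y : omega R), A (a *: x + y) = a *: A x + A y) ->
  (forall k x, (bnorm F (s k) (A x) <= (L k)%:E * bnorm F (s k) x)%E) ->
  exists S : X -> X, [/\ forall x, ilval (S x) = A (ilval x), linear S &
    lbounded L S].
Proof.
move=> linA bA.
have AX (x : X) : A (ilval x) \in lbset (LB F s).
  have := ilvalP x; rewrite !inE => -[k _ /= xk]; exists k => //=.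
  apply: le_lt_trans (bA k _) _.
  have [->|x0] := eqVneq (bnorm F (s k) (ilval x)) 0%E.
    by rewrite mule0 ltry.
  rewrite -(@fineK _ (bnorm F (s k) (ilval x))) -?EFinM ?ltry//.
  by rewrite ge0_fin_numE ?bnorm_ge0.
exists (fun x => IndLim (AX x)); split => //; last by move=> k x; exact: bA.
by move=> a x y; apply: val_inj; exact: linA.
Qed.

(** For [ell] and [dd], |x| <= \hat x and the 1-norm dominates the s_0-norm. For [ces], the sum of
    |x_i| is at most b = ||\hat x||_1, so C_1 |x| <= b / (n + 1) <= b w. *)
Lemma banach_dd1_lbset : banach dd 1 `<=` lbset (LB F s).
Proof.
move=> x x1; have s0 := expo_gt1 s 0; have s00 := expo_gt0 s 0.
have sx1 : (bnorm dd (s 0%N) x < +oo)%E.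
  by apply: le_lt_trans x1; apply: bnorm_le => //; exact: ltW.
have xdd n : ((normc (x n))%:E <= majorant dd x n)%E.
  by apply: ereal_sup_ubound; exists n => /=.
case: F => /=.
- exists 0%N => //=; apply: le_lt_trans sx1; apply: le_lnorm => // n.
  by rewrite lee_fin normc_ge0.
- have /fineK bE : bnorm dd 1 x \is a fin_num.
    by rewrite ge0_fin_numE ?bnorm_ge0.
  set b := fine _ in bE.
  have b0 : 0 <= b by rewrite -lee_fin bE bnorm_ge0.
  apply/set_mem/(@cbox_lbset _ ces _ s b) => // n.
  apply: (@le_trans _ _ (b * harmonic n)%:E); last first.
    by rewrite lee_fin ler_wpM2l// harmonic_le_cesaro.
  rewrite lee_fin /cesaro_op /= ler_wpM2r//.
  under eq_bigr do rewrite expr1n mul1r.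
  rewrite -lee_fin -sumEFin bE.
  apply: (@le_trans _ _ (\sum_(i < n.+1) majorant dd x i)%E).
    by apply: lee_sum => i _.
  rewrite /bnorm lnormE//; last exact: majorant_ge0.
  rewrite invr1 poweRe1; last by apply: nneseries_ge0 => *; exact: poweR_ge0.
  under eq_eseriesr do rewrite poweRe1 ?majorant_ge0//.
  rewrite -(big_mkord xpredT (majorant dd x)).
  by apply: nneseries_lim_ge => *; exact: majorant_ge0.
- by exists 0%N.
Qed.

Lemma eigenseq_banach t m (a : R[i]) : 0 <= t -> t < 1 ->
  banach dd 1 (eigenseq t%:C m a).
Proof.
move=> t0 t1; have [K [r [K0 r0 r1 aK]]] := eigenseq_bound m a t0 t1.
apply: (@le_lt_trans _ _ (lnorm 1 (EFin \o (fun n => K * r ^+ n)))).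
  apply: le_lnorm => // n; first exact: majorant_ge0.
  apply: ge_ereal_sup => _ [k/= nk <-]; rewrite lee_fin.
  apply: le_trans (aK k) _; rewrite ler_wpM2l// ler_wiXn2l//; exact: ltW.
apply: (@lnorm_lty _ _ _ (K / (1 - r))) => // n.
  by rewrite mulr_ge0// exprn_ge0.
under eq_bigr do rewrite powRr1 ?mulr_ge0 ?exprn_ge0//.
by rewrite -mulr_sumr ler_wpM2l// big_mkord geometric_sum_le.
Qed.

Lemma normalized_unit n : exists u : X,
  [/\ forall k, (k < n)%N -> ilval u k = 0,
      forall k, (majorant F (ilval u) k <= 1)%E &
      (1 <= majorant F (ilval u) n)%E].
Proof.
(* For [ces] the majorant of the n-th unit vector peaks at 1 / (n + 1), hence the rescaling. *)
pose a : R := if F is ces then n.+1%:R else 1.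
have a0 : 0 <= a by rewrite /a; case: F.
pose u : omega R := fun k => if k == n then a%:C else 0.
have normu k : normc (u k) = if k == n then a else 0.
  by rewrite /u; case: ifP; rewrite ?normc0// normc_real ger0_norm.
have u1 : u \in lbset (LB F s).
  apply/mem_set/banach_dd1_lbset.
  apply: (@le_lt_trans _ _ (n.+1%:R * a)%:E); last exact: ltry.
  apply: le_trans _ (lnorm_head n.+1 (lexx 1) a0).
  apply: le_lnorm => // k; first exact: majorant_ge0.
  apply: ge_ereal_sup => _ [j/= kj <-]; rewrite normu ltnS.
  by case: eqVneq kj => [-> ->//|_ _]; case: ifP.
exists (IndLim u1); split => [k kn|k|] /=.
- by rewrite /u ltn_eqF.
- case: (F) @a a0 @u normu {u1} => a a0 u normu.
  + by rewrite le_majorant_cst// => j; rewrite normu; case: ifP.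
  + rewrite lee_fin /cesaro_op ler_pdivrMr// mul1r.
    under eq_bigr do rewrite expr1n mul1r normu.
    rewrite -big_mkcond/=; have [nk|kn] := leqP n k.
      rewrite (bigD1 (Ordinal (nk : n < k.+1)%N))//= big1 ?addr0 ?ler_nat//.
      by move=> i /andP[/eqP iE]; rewrite -val_eqE/= iE eqxx.
    rewrite big_pred0// => i; apply/negbTE; rewrite neq_ltn.
    by rewrite (leq_ltn_trans _ kn)// -ltnS.
  + by rewrite le_majorant_cst// => j; rewrite normu; case: ifP.
- case: (F) @a a0 @u normu {u1} => a a0 u normu.
  + by rewrite /= normu eqxx.
  + rewrite lee_fin /cesaro_op ler_pdivlMr// mul1r.
    rewrite big_ord_recr/= expr1n mul1r normu eqxx lerDr.
    by apply: sumr_ge0 => i _; rewrite expr1n mul1r normc_ge0.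
  + apply: (@le_trans _ _ (normc (u n))%:E); first by rewrite normu eqxx.
    by apply: ereal_sup_ubound; exists n => /=.
Qed.

Lemma cesaro_lift t : 0 <= t -> t < 1 -> exists T : {linear X -> X},
  (forall x, ilval (T x) = cesaro_op t%:C (ilval x)) /\
  exists2 L, forall k, 0 < L k & lbounded L T.
Proof.
move=> t0 t1.
have [|k x|S [SE linS bS]] := @lift_operator (cesaro_op t%:C)
    (fun k => 1 / (1 - t) * harmonic_norm k + 1).
- exact: cesaro_op_linear.
- apply: bnorm_cesaro => // n; rewrite mul1r; exact: normc_cesaro.
exists (HB.pack_for {linear X -> X} S
  (GRing.isLinear.Build _ _ _ _ S linS)); split => //.
exists (fun k => 1 / (1 - t) * harmonic_norm k + 1) => // k.
by rewrite ltr_wpDl// mulr_ge0 ?harmonic_norm_ge0// divr_ge0// subr_ge0 ltW.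
Qed.

(** * Eigenvectors, resolvents and ranges of C_t *)

Section spectrum.
Context {t : R} (t0 : 0 <= t) (t1 : t < 1) (T : {linear X -> X})
  (TE : forall x, ilval (T x) = cesaro_op t%:C (ilval x)).

Lemma pencilE l (x : X) n :
  ilval (pencil T l x) n = l * ilval x n - cesaro_op t%:C (ilval x) n.
Proof. by rewrite -TE. Qed.

Lemma pencilB l (x y : X) : pencil T l (x - y) = pencil T l x - pencil T l y.
Proof. by rewrite /pencil scalerBr linearB opprD addrACA opprD. Qed.

Lemma pencil_eq0 l (x : X) : pencil T l x = 0 ->
  (forall n, l = n.+1%:R^-1 -> ilval x n = 0) -> x = 0.
Proof.
move=> lx x0; apply: ilval_ext => n.
apply: (cesaro_eigen_eq0 (t := t%:C) (l := l)) => // k.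
by apply/eqP; rewrite -subr_eq0 -pencilE lx.
Qed.

Definition eigenvector m (a : R[i]) : X :=
  IndLim (mem_set (banach_dd1_lbset (eigenseq_banach m a t0 t1))).

Lemma pencil_eigenvector m a : pencil T m.+1%:R^-1 (eigenvector m a) = 0.
Proof.
apply: ilval_ext => n.
by rewrite pencilE cesaro_eigenseq seq_scaleE subrr.
Qed.

Lemma eigenvectorZ m a : eigenvector m a = a *: eigenvector m 1.
Proof. by apply: val_inj; exact: eigenseqZ. Qed.

(** The eigenvector has m-th coordinate 1; subtracting x_m times it from x leaves a solution
    vanishing at m, hence 0 by triangularity. *)
Lemma eigenspaceE m (x : X) : pencil T m.+1%:R^-1 x = 0 <->
  x = ilval x m *: eigenvector m 1.
Proof.
split=> [mx|->]; last by rewrite -eigenvectorZ pencil_eigenvector.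
apply/eqP; rewrite -subr_eq0; apply/eqP; apply: (pencil_eq0 (l := m.+1%:R^-1)).
  by rewrite pencilB mx -eigenvectorZ pencil_eigenvector subrr.
move=> n /invr_inj/eqP; rewrite eqr_nat => /eqP[->].
change (ilval x n - ilval x n * eigenseq t%:C n 1 n = 0).
by rewrite eigenseq_diag mulr1 subrr.
Qed.

Lemma pencil_not_injective m : ~ injective (pencil T m.+1%:R^-1).
Proof.
move=> inj; have : eigenvector m 1 = 0.
  by apply: inj; rewrite pencil_eigenvector /pencil scaler0 linear0 subrr.
move=> /(congr1 (fun x => ilval x m)).
change (eigenseq t%:C m 1 m = 0 -> False).
by rewrite eigenseq_diag => /eqP; rewrite oner_eq0.
Qed.

Lemma point_spectrumE : point_spectrum T = @Lambda R[i].
Proof.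
apply/seteqP; split=> [l|_ [m _ <-]]; last exact: pencil_not_injective.
apply: contra_notP => lL x y xy; apply/eqP; rewrite -subr_eq0; apply/eqP.
apply: (pencil_eq0 (l := l)); first by rewrite pencilB xy subrr.
by move=> n ln; case: lL; exists n.
Qed.

(** The constants M are chosen before mu, as equicontinuity requires. Eigenvalues are allowed for
    mu, where G yields preimages of vectors of zero defect. *)
Lemma resolvent_candidate c d L : 0 < c -> 0 < d -> 0 <= L ->
  exists2 M, forall k, 0 < M k & forall mu, c <= normc mu -> normc mu <= L ->
    (forall n, mu != n.+1%:R^-1 -> d <= normc (mu - n.+1%:R^-1)) ->
    exists G : X -> X, [/\ linear G, lbounded M G & forall y, ilval (G y) =
      mu^-1 *: (ilval y + image_sol t%:C mu (ilval y))].
Proof.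
move=> c0 d0 L0; have [K [r [K0 r0 r1 zK]]] := image_sol_bound t0 t1 c0 d0 L0.
pose M k := c^-1 * (1 + (K / (1 - r) * harmonic_norm k + 1)).
exists M => [k|mu cmu muL mud].
  rewrite mulr_gt0 ?invr_gt0// addr_gt0// ltr_wpDl//.
  by rewrite mulr_ge0 ?harmonic_norm_ge0// divr_ge0// subr_ge0 ltW.
have [a x y|k x|G [GE linG bG]] := @lift_operator
    (fun y => mu^-1 *: (y + image_sol t%:C mu y)) M; last by exists G.
- rewrite image_sol_linear; apply/funext => n.
  rewrite !(seq_addE, seq_scaleE); ring.
- rewrite bnormZ ?expo_gt0// normcV /M EFinM -muleA.
  have mu0 : 0 < normc mu by exact: lt_le_trans cmu.
  apply: lee_pmul; rewrite ?lee_fin ?invr_ge0 ?bnorm_ge0 ?(ltW mu0)//.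
    by rewrite lef_pV2.
  apply: le_trans (bnormD _ _ _ (ltW (expo_gt1 s k))) _.
  rewrite EFinD ge0_muleDl ?lee_fin ?mul1e//; last first.
    rewrite addr_ge0// mulr_ge0 ?harmonic_norm_ge0// divr_ge0//.
    by rewrite subr_ge0 ltW.
  by apply: leeD => //; apply: bnorm_cesaro => //; exact: zK.
Qed.

Lemma resolvent_candidateP mu (G : X -> X) : mu != 0 ->
  (forall y, ilval (G y) =
    mu^-1 *: (ilval y + image_sol t%:C mu (ilval y))) ->
  forall y,
  (forall n, image_eq t%:C mu (ilval y) (image_sol t%:C mu (ilval y)) n) ->
  pencil T mu (G y) = y.
Proof.
move=> mu0 GE y yz; apply: ilval_ext => n.
rewrite pencilE GE cesaro_of_image_eq// seq_scaleE mulrA mulfV// mul1r.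
by rewrite seq_addE addrK.
Qed.

Lemma is_resolvent_candidate mu (G : X -> X) M : mu != 0 ->
  ~ (@Lambda R[i]) mu -> linear G -> (forall k, 0 < M k) -> lbounded M G ->
  (forall y, ilval (G y) =
    mu^-1 *: (ilval y + image_sol t%:C mu (ilval y))) ->
  is_resolvent T mu G.
Proof.
move=> mu0 muL linG M0 bG GE.
have muN n : mu != n.+1%:R^-1 by apply/eqP => muE; apply: muL; exists n.
split=> //; first exact: continuous_lbounded bG.
- move=> x; apply: ilval_ext => n.
  rewrite GE seq_scaleE seq_addE -(@image_eq_uniq _ _ _ _
      (cesaro_op t%:C (ilval x))) ?pencilE//.
    by rewrite subrK mulrA mulVf// mul1r.
  by apply: image_eq_cesaro => k; rewrite pencilE.
- move=> y; apply: resolvent_candidateP => // n; exact: image_sol_eq.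
Qed.

Lemma is_resolvent_uniq mu (S S' : X -> X) :
  is_resolvent T mu S -> is_resolvent T mu S' -> S = S'.
Proof.
move=> [_ _ SK _] [_ _ _ S'K]; apply/funext => y.
by rewrite -{1}(S'K y) SK.
Qed.

Lemma resolvent_set_star_sub : resolvent_set_star T `<=` resolvent_set T.
Proof. by move=> l [d d0 [dT _]]; apply: dT; exact: ballxx. Qed.

Lemma Lambda_not_resolvent l : @Lambda R[i] l -> ~ resolvent_set T l.
Proof.
move=> [m _ <-] [S [_ _ SK _]]; apply: (@pencil_not_injective m).
exact: can_inj SK.
Qed.

(** On the disc of radius min (d / 2) (|l| / 2) every mu satisfies |mu| >= |l| / 2 and stays d / 2
    away from Lambda, so a single M bounds all resolvents. *)
Lemma resolvent_set_starP l : l != 0 -> ~ @Lambda R[i] l ->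
  resolvent_set_star T l.
Proof.
move=> l0 lL; have nl0 : 0 < normc l by rewrite normc_gt0.
have [d d0 ld] := Lambda_gap l0.
have lN n : l != n.+1%:R^-1 by apply/eqP => lE; apply: lL; exists n.
pose e := Num.min (d / 2) (normc l / 2).
have e0 : 0 < e by rewrite lt_min !divr_gt0.
have [M M0 MG] := @resolvent_candidate (normc l / 2) (d / 2)
  (normc l + normc l / 2) (divr_gt0 nl0 (ltr0n _ 2)) (divr_gt0 d0 (ltr0n _ 2))
  (addr_ge0 (ltW nl0) (divr_ge0 (ltW nl0) (ler0n _ 2))).
have ballP mu : normc (l - mu) < e -> exists G, linear G /\ lbounded M G /\
    is_resolvent T mu G.
  move=> lmu; have /andP[lmud lmul] :
      (normc (l - mu) < d / 2) && (normc (l - mu) < normc l / 2).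
    by rewrite -lt_min.
  have mu_ge : normc l / 2 <= normc mu.
    have := normcB_ge l (l - mu); rewrite subKr; lra.
  have mud n : d / 2 <= normc (mu - n.+1%:R^-1).
    have := normcB_ge (l - n.+1%:R^-1) (l - mu).
    have -> : l - n.+1%:R^-1 - (l - mu) = mu - n.+1%:R^-1 by ring.
    have := ld n (lN n); lra.
  have [|//|G [linG bG GE]] := MG mu mu_ge.
    have := normcB_ge mu l; rewrite -(normcN (mu - l)) opprB; lra.
  exists G; split => //; split => //.
  apply: (is_resolvent_candidate _ _ linG M0 bG GE).
    by rewrite -normc_gt0 (lt_le_trans _ mu_ge)// divr_gt0.
  move=> [n _ nmu]; have := mud n; rewrite nmu subrr normc0 leNgt.
  by rewrite divr_gt0.
exists e%:C; first by rewrite ltcR.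
have ball_normc mu : `|l - mu| < e%:C -> normc (l - mu) < e.
  by rewrite -[normc _ < _]ltcR.
split=> [mu /ball_normc/ballP[G [_ [_ GT]]]|]; first by exists G.
apply: (equicontinuous_lbounded M0) => S.
move=> [mu /ball_normc/ballP[G [linG [bG GT]]] ST].
by rewrite (is_resolvent_uniq ST GT).
Qed.

Lemma cesaro_cbox (x : X) : ubox (F := F) (s := s) 1 x ->
  cbox (F := F) (s := s) (1 * (1 / (1 - t))) (T x).
Proof.
move=> x1 n; rewrite TE.
apply: (majorant_cesaro t0 t1 ler01 x1) => k; rewrite mul1r.
exact: normc_cesaro.
Qed.

Lemma cbox_radius_ge0 : 0 <= 1 * (1 / (1 - t)).
Proof. by rewrite !mul1r invr_ge0 subr_ge0 ltW. Qed.

Lemma compact_cesaro : compact_operator T.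
Proof.
exists (ubox (F := F) (s := s) 1).
  exists (ubox 1); first exact: ind_base_ubox.
  by move=> x; rewrite add0r.
exists (cbox (1 * (1 / (1 - t)))).
  by move=> _ [x x1 <-]; exact: cesaro_cbox.
split; last exact: closed_cbox.
exact/compact_cbox/cbox_radius_ge0.
Qed.

(** A continuous inverse S of -C_t would send some neighbourhood of 0 into [ubox (1/2)]. The images
    of the normalized units lie in one fixed [cbox] and vanish before n, so for suitable n they
    enter that neighbourhood, while the unit has a majorant value at least 1. *)
Lemma zero_not_resolvent : ~ resolvent_set T 0.
Proof.
move=> [S [_ contS SK _]].
have S0 : S 0 = 0 by have := SK 0; rewrite /pencil scale0r linear0 subrr.
have half0 : 0 < 2^-1 :> R by [].
have : nbhs (0 : X) (S @^-1` ubox (F := F) (s := s) 2^-1).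
  apply: contS; rewrite S0; exists (ubox 2^-1); first exact: ind_base_ubox.
  by move=> x; rewrite add0r.
move=> /(cbox_nbhs0 cbox_radius_ge0)[n [d d0 nd]].
have [u [u0 u1 un]] := normalized_unit n.
have /nd : cbox (F := F) (s := s) (1 * (1 / (1 - t))) (pencil T 0 u).
  apply: (majorant_cesaro t0 t1 ler01 u1) => k; rewrite mul1r pencilE.
  by rewrite mul0r sub0r normcN normc_cesaro.
move=> H; have /(_ n) : ubox (F := F) (s := s) 2^-1 u.
  rewrite -[u]SK; apply: H => k kn.
  rewrite pencilE mul0r sub0r normcN /cesaro_op big1 ?mul0r ?normc0// => i _.
  by rewrite u0 ?mulr0// (leq_ltn_trans _ kn)// -ltnS.
move=> /(le_trans un); rewrite lee_fin leNgt => /negP; apply.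
by rewrite invf_lt1// ltr1n.
Qed.

Lemma spectrumE : spectrum T = @Lambda R[i] `|` [set 0].
Proof.
apply/seteqP; split=> [l lT|l [/Lambda_not_resolvent//|->]]; last first.
  exact: zero_not_resolvent.
apply: contrapT => /not_orP[lL /eqP l0]; apply: lT.
exact/resolvent_set_star_sub/resolvent_set_starP.
Qed.

Lemma spectrum_starE : spectrum_star T = spectrum T.
Proof.
apply/seteqP; split=> [|l lT /resolvent_set_star_sub//].
apply: subsetC => l lT.
have [l0|l0] := eqVneq l 0; first by case: zero_not_resolvent; rewrite -l0.
apply: resolvent_set_starP => // lL.
exact: Lambda_not_resolvent lL lT.
Qed.

(** Necessity is the equation of index m. Sufficiency uses the candidate at mu = 1 / (m + 1), with
    [Lambda_gap] separating it from the other eigenvalues. *)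
Lemma range_pencilE m (y : X) :
  range (pencil T m.+1%:R^-1) y <-> defect t%:C m (ilval y) = 0.
Proof.
have l0 : m.+1%:R^-1 != 0 :> R[i] by rewrite invr_eq0 pnatr_eq0.
split=> [[x _ <-]|ym].
  apply: (@defect_eq0 _ _ _ _ (cesaro_op t%:C (ilval x))).
  by apply: image_eq_cesaro => n; rewrite pencilE.
have [d d0 ld] := Lambda_gap l0.
have nl0 : 0 < normc (m.+1%:R^-1 : R[i]) by rewrite normc_gt0.
have [M _ MG] := resolvent_candidate nl0 d0 (ltW nl0).
have [G [_ _ GE]] := MG _ (lexx _) (lexx _) ld.
exists (G y) => //; apply: resolvent_candidateP => //.
exact: image_sol_defect.
Qed.

Lemma closed_range_pencil m : closed (range (pencil T m.+1%:R^-1)).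
Proof.
move=> y cly; apply/range_pencilE; have [B B0 DB] := defect_bound t%:C m.
apply/eqP; rewrite -normc_le0; apply/ler_addgt0Pr => e e0; rewrite add0r.
have B1 : 0 < B + 1 by rewrite ltr_wpDl.
have [x [/range_pencilE x0 yx]] :=
  cly _ (near_coord y m (divr_gt0 e0 B1)).
have -> : defect t%:C m (ilval y) = defect t%:C m (ilval y - ilval x).
  rewrite [_ - _](_ : _ = (-1) *: ilval x + ilval y); last first.
    by rewrite scaleN1r addrC.
  by rewrite defect_linear x0 mulr0 add0r.
apply: le_trans (DB _ (e / (B + 1)) _) _; first by move=> k /yx/ltW.
by rewrite mulrA ler_pdivrMr// mulrC ler_wpM2l ?lerDl// ltW.
Qed.

(** The range is the kernel of the defect functional, which equals 1 on the eigenvector; the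
    coefficient of x is therefore forced to be its defect. *)
Lemma codim_range_pencil m : has_codim (range (pencil T m.+1%:R^-1)) 1.
Proof.
exists (fun=> eigenvector m 1) => x.
have codimP (c : 'rV[R[i]]_1) : range (pencil T m.+1%:R^-1)
    (x - \sum_i c 0 i *: eigenvector m 1) <-> defect t%:C m (ilval x) = c 0 0.
  rewrite big_ord1 addrC -scaleNr range_pencilE.
  rewrite [ilval _](_ : _ = - c 0 0 *: eigenseq t%:C m 1 + ilval x)//.
  rewrite defect_linear defect_eigenseq mulr1 addrC.
  by split=> [/eqP|->]; rewrite ?subr_eq0 ?subrr// => /eqP.
exists (\row_i defect t%:C m (ilval x)); split.
  by apply/codimP; rewrite mxE.
by move=> c /codimP xc; apply/rowP => i; rewrite mxE xc ord1.
Qed.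

Lemma dim_eigenspace m : has_dim [set x | pencil T m.+1%:R^-1 x = 0] 1.
Proof.
exists (fun=> eigenvector m 1); split=> [_|x /= /eigenspaceE xE].
  exact: pencil_eigenvector.
exists (\row_i ilval x m); split; first by rewrite big_ord1 mxE.
move=> c; rewrite big_ord1 => xc; apply/rowP => i; rewrite mxE ord1 xc.
change (c 0 0 * eigenseq t%:C m 1 m = c 0 0).
by rewrite eigenseq_diag mulr1.
Qed.

Lemma eigenspace_span m a : a != 0 ->
  [set ilval x | x in [set x | pencil T m.+1%:R^-1 x = 0]] =
  [set c *: eigenseq t%:C m a | c in [set: R[i]]].
Proof.
move=> a0; apply/seteqP; split=> [_ [x /eigenspaceE xE <-]|_ [c _ <-]].
  exists (ilval x m / a) => //; rewrite [in RHS]xE eigenseqZ scalerA divfK//.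
exists (c *: eigenvector m a) => //=.
by rewrite eigenvectorZ scalerA -eigenvectorZ pencil_eigenvector.
Qed.

End spectrum.
End generalized_cesaro.

Theorem theorem5p3 (R : realType) (t : R) (F : seqfamily) (p : \bar R)
    (s : exponents p) :
  0 <= t -> t < 1 -> (1 < p)%E ->
  let X : tvsType R[i] := indlim (LB F s) in
  exists T : {linear X -> X},
    [/\ forall x, ilval (T x) = cesaro_op t%:C (ilval x),
        continuous T /\ compact_operator T,
        [/\ point_spectrum T = @Lambda R[i],
            spectrum_star T = spectrum T &
            spectrum T = @Lambda R[i] `|` [set 0]],
        forall l, point_spectrum T l ->
          closed (range (pencil T l)) /\ has_codim (range (pencil T l)) 1 &
        forall (m : nat) (alpha : R[i]), alpha != 0 ->
          let Ker := [set x | pencil T m.+1%:R^-1 x = 0] in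
          let xm := eigenseq t%:C m alpha in
          [/\ has_dim Ker 1,
              [set ilval x | x in Ker] = [set c *: xm | c in [set: R[i]]],
              banach dd 1 xm &
              banach dd 1 `<=` lbset (LB F s)]].
Proof.
move=> t0 t1 _ X.
have [T [TE [L L0 bT]]] := @cesaro_lift R F p s t t0 t1.
exists T; split=> //.
- split; last exact: (compact_cesaro t0 t1 TE).
  by apply: (continuous_lbounded L0 _ bT); exact: linearP.
- split; first exact: (point_spectrumE t0 t1 TE).
  + exact: (spectrum_starE t0 t1 TE).
  + exact: (spectrumE t0 t1 TE).
- move=> l; rewrite (point_spectrumE t0 t1 TE) => -[m _ <-].
  split; first exact: (closed_range_pencil t0 t1 TE).
  exact: (codim_range_pencil t0 t1 TE).
- move=> m a a0 /=; split.
  + exact: (dim_eigenspace t0 t1 TE).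
  + exact: (eigenspace_span t0 t1 TE m a0).
  + exact: eigenseq_banach.
  + exact: banach_dd1_lbset.
Qed.
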